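(* Let $K$ be a field of characteristic $0$, let $f:\mathbb{N}\to K$ be a multiplicative function, and suppose that its generating series $F(z)=\sum_{n\geq 1} f(n)z^n\in K[[z]]$ is algebraic over $K(z)$. Then either there is a natural number $k$ and a periodic multiplicative function $\chi:\mathbb{N}\to K$ such that $f(n)=n^k \chi(n)$ for all $n\in\mathbb{N}$, or $f(n)$ is eventually zero (i.e. $f(n)=0$ for all sufficiently large $n$).
   Context: $\mathbb{N}=\{1,2,3,\ldots\}$. A function $f$ on $\mathbb{N}$ is multiplicative if $f(mn)=f(m)f(n)$ whenever $\gcd(m,n)=1$. A function $\chi$ on $\mathbb{N}$ is periodic if there is $d\in\mathbb{N}$ with $\chi(n+d)=\chi(n)$ for all $n$. *)

(* Defs.v *)
From HB Require Import structures.
From mathcomp Require Import all_boot all_algebra.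
From mathcomp Require Import boolp.

Set Implicit Arguments.
Unset Strict Implicit.
Unset Printing Implicit Defensive.

Import GRing.Theory.
Local Open Scope ring_scope.
Local Open Scope quotient_scope.

(* The ring R[[z]]. The record wrapper keeps the Cauchy product apart from the
   pointwise ring structure on nat -> R. *)
Record fps (R : Type) := Fps { fps_coef :> nat -> R }.

Section FpsRing.
Variable R : comNzRingType.
Implicit Types f g h : fps R.

HB.instance Definition _ := gen_eqMixin (fps R).
HB.instance Definition _ := gen_choiceMixin (fps R).

Lemma fpsP f g : f =1 g -> f = g.
Proof. by case: f g => [f] [g] /= /funext ->. Qed.

Definition fps_zero : fps R := Fps (fun=> 0).
Definition fps_one : fps R := Fps (fun n => (n == 0%N)%:R).
Definition fps_opp f : fps R := Fps (fun n => - f n).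
Definition fps_add f g : fps R := Fps (fun n => f n + g n).
Definition fps_mul f g : fps R :=
  Fps (fun n => \sum_(i < n.+1) f i * g (n - i)%N).

Lemma fps_addA : associative fps_add.
Proof. by move=> f g h; apply: fpsP => n /=; rewrite addrA. Qed.

Lemma fps_addC : commutative fps_add.
Proof. by move=> f g; apply: fpsP => n /=; rewrite addrC. Qed.

Lemma fps_add0 : left_id fps_zero fps_add.
Proof. by move=> f; apply: fpsP => n /=; rewrite add0r. Qed.

Lemma fps_addN : left_inverse fps_zero fps_opp fps_add.
Proof. by move=> f; apply: fpsP => n /=; rewrite addNr. Qed.

HB.instance Definition _ :=
  GRing.isZmodule.Build (fps R) fps_addA fps_addC fps_add0 fps_addN.

Lemma fps_mul_trunc N f g n : (n < N)%N ->
  fps_mul f g n = ((\poly_(i < N) f i) * (\poly_(i < N) g i))`_n.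
Proof.
move=> nN; rewrite coefM; apply: eq_bigr => -[i /=]; rewrite ltnS => ile _.
by rewrite !coef_poly (leq_ltn_trans ile nN) (leq_ltn_trans (leq_subr _ _) nN).
Qed.

Lemma fps_trunc_mul N f g n : (n < N)%N ->
  (\poly_(i < N) fps_mul f g i)`_n
  = ((\poly_(i < N) f i) * (\poly_(i < N) g i))`_n.
Proof. by move=> nN; rewrite coef_poly nN (fps_mul_trunc _ _ nN). Qed.

Lemma fps_mulC : commutative fps_mul.
Proof.
by move=> f g; apply: fpsP => n; rewrite !(@fps_mul_trunc n.+1) // mulrC.
Qed.

Lemma fps_mulA : associative fps_mul.
Proof.
move=> f g h; apply: fpsP => n; rewrite !(@fps_mul_trunc n.+1) //.
transitivity ((\poly_(i < n.+1) f i * (\poly_(i < n.+1) g i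
                * \poly_(i < n.+1) h i))`_n).
  rewrite !coefM; apply: eq_bigr => i _.
  by rewrite fps_trunc_mul // ltnS leq_subr.
rewrite mulrA !coefM; apply: eq_bigr => i _.
by rewrite fps_trunc_mul.
Qed.

Lemma fps_mul1 : left_id fps_one fps_mul.
Proof.
move=> f; apply: fpsP => n /=; rewrite big_ord_recl /= mul1r subn0.
by rewrite big1 ?addr0 // => i _; rewrite mul0r.
Qed.

Lemma fps_mulDl : left_distributive fps_mul fps_add.
Proof.
move=> f g h; apply: fpsP => n /=; rewrite -big_split /=.
by apply: eq_bigr => i _; rewrite mulrDl.
Qed.

Lemma fps_one_neq0 : fps_one != 0.
Proof.
by apply/eqP => /(congr1 (fun f : fps R => f 0%N)) /= /eqP; rewrite oner_eq0.
Qed.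

HB.instance Definition _ := GRing.Zmodule_isComNzRing.Build (fps R)
  fps_mulA fps_mulC fps_mul1 fps_mulDl fps_one_neq0.

Lemma fpsM f g n : (f * g) n = \sum_(i < n.+1) f i * g (n - i)%N.
Proof. by []. Qed.

Definition fps_unit : pred (fps R) := fun f => `[< exists g, g * f = 1 >].

Definition fps_inv f : fps R :=
  if pselect (exists g, g * f = 1) is left gf1 then projT1 (cid gf1) else f.

Lemma fps_mulV : {in fps_unit, left_inverse 1 fps_inv *%R}.
Proof.
move=> f /asboolP uf; rewrite /fps_inv; case: pselect => // gf1.
exact: (projT2 (cid gf1)).
Qed.

Lemma fps_unitP f g : g * f = 1 -> f \in fps_unit.
Proof. by move=> gf1; apply/asboolP; exists g. Qed.

Lemma fps_inv_out : {in [predC fps_unit], fps_inv =1 id}.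
Proof.
by move=> f /asboolPn nuf; rewrite /fps_inv; case: pselect.
Qed.

HB.instance Definition _ := GRing.ComNzRing_hasMulInverse.Build (fps R)
  fps_mulV fps_unitP fps_inv_out.

Definition fps_of_poly (p : {poly R}) : fps R := Fps (fun n => p`_n).

Lemma fps_of_poly_is_zmod_morphism : zmod_morphism fps_of_poly.
Proof. by move=> p q; apply: fpsP => n /=; rewrite coefB. Qed.

Lemma fps_of_poly_is_monoid_morphism : monoid_morphism fps_of_poly.
Proof.
split; first by apply: fpsP => n /=; rewrite coef1.
by move=> p q; apply: fpsP => n /=; rewrite coefM.
Qed.

HB.instance Definition _ := GRing.isZmodMorphism.Build {poly R} (fps R)
  fps_of_poly fps_of_poly_is_zmod_morphism.
HB.instance Definition _ := GRing.isMonoidMorphism.Build {poly R} (fps R)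
  fps_of_poly fps_of_poly_is_monoid_morphism.

Lemma fps_of_poly_inj : injective fps_of_poly.
Proof.
move=> p q pq; apply/polyP => n.
exact: (congr1 (fun f : fps R => f n) pq).
Qed.

End FpsRing.

Section FpsDomain.
Variable R : idomainType.
Implicit Types f g : fps R.

Lemma fps_neq0P f : f != 0 ->
  exists2 m, f m != 0 & forall i, (i < m)%N -> f i = 0.
Proof.
move=> fn0; have exf : exists n, f n != 0.
  apply: contrapT => /forallNP f0; case/eqP: fn0; apply: fpsP => n.
  by apply/eqP; apply: contrapT => /negP; apply: f0.
case: (ex_minnP exf) => m fm minm; exists m => // i im.
by apply/eqP; apply: contraLR im => /minm; rewrite -leqNgt.
Qed.

Lemma fps_integral f g : f * g = 0 -> (f == 0) || (g == 0).
Proof.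
move=> fg0; apply: contraT; rewrite negb_or => /andP[].
move=> /fps_neq0P[a fa lta] /fps_neq0P[b gb ltb].
have := congr1 (fun f : fps R => f (a + b)%N) fg0; rewrite fpsM.
have lt_a : (a < (a + b).+1)%N by rewrite ltnS leq_addr.
rewrite (bigD1 (Ordinal lt_a)) //= addKn big1 ?addr0 => [/eqP|i nia].
  by rewrite mulf_eq0 (negPf fa) (negPf gb).
have [ia|ai|ia] := ltngtP i a; first by rewrite lta ?mul0r.
  rewrite ltb ?mulr0 // ltn_subLR ?ltn_add2r //.
  by rewrite -ltnS ltn_ord.
by rewrite -val_eqE /= ia eqxx in nia.
Qed.

HB.instance Definition _ := GRing.ComUnitRing_isIntegral.Build (fps R)
  fps_integral.

End FpsDomain.

Notation ratfun K := {fraction {poly K}}.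
Notation laurent K := {fraction (fps K)}.

Section RatfunLaurent.
Variable K : fieldType.

Definition fps_to_laurent (f : fps K) : laurent K := FracField.tofrac f.

(* The embedding of K(z) in K((z)), computed on a representative p / q;
   ratfun_to_laurentE shows the choice of p / q is immaterial. *)
Definition ratfun_to_laurent (x : ratfun K) : laurent K :=
  fps_to_laurent (fps_of_poly \n_(repr x)) /
  fps_to_laurent (fps_of_poly \d_(repr x)).

Let phi (p : {poly K}) : laurent K := fps_to_laurent (fps_of_poly p).

Let phiM p q : phi (p * q) = phi p * phi q.
Proof. by rewrite /phi /fps_to_laurent !rmorphM. Qed.

Let phiB p q : phi (p - q) = phi p - phi q.
Proof. by rewrite /phi /fps_to_laurent !rmorphB. Qed.

Let phi_eq0 p : (phi p == 0) = (p == 0).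
Proof.
by rewrite /phi /fps_to_laurent tofrac_eq0 -(inj_eq (@fps_of_poly_inj K)) rmorph0.
Qed.

Lemma ratfun_numden (x : ratfun K) :
  x = FracField.tofrac \n_(repr x) / FracField.tofrac \d_(repr x).
Proof.
have dn0 : FracField.tofrac \d_(repr x) != 0 :> ratfun K.
  by rewrite tofrac_eq0 denom_ratioP.
apply: (mulIf dn0); rewrite mulfVK //.
have mulE (y z : ratfun K) : y * z = FracField.mul y z by [].
rewrite mulE -{1}[x]reprK; unlock FracField.tofrac.
rewrite -FracField.pi_mul; apply/eqP; rewrite FracField.equivf_def.
rewrite /FracField.mulf !numden_Ratio ?mulr1 ?oner_neq0 ?denom_ratioP //.
by rewrite mulrC.
Qed.

Let phi_div (p q r s : {poly K}) : q != 0 -> s != 0 ->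
  FracField.tofrac p / FracField.tofrac q
    = FracField.tofrac r / FracField.tofrac s :> ratfun K ->
  phi p / phi q = phi r / phi s.
Proof.
move=> q0 s0 /eqP; rewrite eqr_div ?tofrac_eq0 // -!tofracM tofrac_eq.
by move=> /eqP psrq; apply/eqP; rewrite eqr_div ?phi_eq0 // -!phiM psrq.
Qed.

Lemma ratfun_to_laurentE (p q : {poly K}) : q != 0 ->
  ratfun_to_laurent (FracField.tofrac p / FracField.tofrac q)
  = fps_to_laurent (fps_of_poly p) / fps_to_laurent (fps_of_poly q).
Proof.
move=> q0; apply: phi_div => //; first exact: denom_ratioP.
by rewrite -ratfun_numden.
Qed.

Lemma ratfun_to_laurent_is_zmod_morphism : zmod_morphism ratfun_to_laurent.
Proof.
move=> x y; rewrite (ratfun_numden x) (ratfun_numden y).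
have [dx dy] := (denom_ratioP (repr x), denom_ratioP (repr y)).
move: \n_(repr x) \d_(repr x) \n_(repr y) \d_(repr y) dx dy.
move=> a b c d b0 d0; rewrite -mulNr addf_div ?tofrac_eq0 // mulNr.
rewrite -!tofracM -tofracB !ratfun_to_laurentE ?mulf_neq0 //.
rewrite -!/(phi _) phiB !phiM -[X in _ = _ + X]mulNr addf_div ?phi_eq0 //.
by rewrite mulNr.
Qed.

Lemma ratfun_to_laurent_is_monoid_morphism : monoid_morphism ratfun_to_laurent.
Proof.
split.
  have -> : 1 = FracField.tofrac 1 / FracField.tofrac 1 :> ratfun K.
    by rewrite rmorph1 divr1.
  by rewrite ratfun_to_laurentE ?oner_neq0 // divff // phi_eq0 oner_eq0.
move=> x y; rewrite (ratfun_numden x) (ratfun_numden y).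
have [dx dy] := (denom_ratioP (repr x), denom_ratioP (repr y)).
move: \n_(repr x) \d_(repr x) \n_(repr y) \d_(repr y) dx dy.
move=> a b c d b0 d0; rewrite mulf_div -!tofracM.
rewrite !ratfun_to_laurentE ?mulf_neq0 //.
by rewrite -!/(phi _) !phiM mulf_div.
Qed.

HB.instance Definition _ := GRing.isZmodMorphism.Build
  (ratfun K) (laurent K) ratfun_to_laurent ratfun_to_laurent_is_zmod_morphism.
HB.instance Definition _ := GRing.isMonoidMorphism.Build
  (ratfun K) (laurent K) ratfun_to_laurent ratfun_to_laurent_is_monoid_morphism.

End RatfunLaurent.

Definition fps_algebraic (K : fieldType) (F : fps K) : Prop :=
  algebraicOver (@ratfun_to_laurent K) (fps_to_laurent F).

(* A function on {1, 2, 3, ...} is represented by f : nat -> K, whose value at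
   0 is junk: none of the definitions below depends on f 0. *)
Definition multiplicative_fun (K : fieldType) (f : nat -> K) : Prop :=
  forall m n : nat, (0 < m)%N -> (0 < n)%N -> coprime m n ->
    f (m * n)%N = f m * f n.

Definition periodic_fun (K : fieldType) (chi : nat -> K) : Prop :=
  exists2 d : nat, (0 < d)%N &
    forall n : nat, (0 < n)%N -> chi (n + d)%N = chi n.

Definition generating_series (K : fieldType) (f : nat -> K) : fps K :=
  Fps (fun n => if n == 0%N then 0 else f n).

Definition eventually_zero (K : fieldType) (f : nat -> K) : Prop :=
  exists N : nat, forall n : nat, (N < n)%N -> f n = 0.

(* Main.v *)
From HB Require Import structures.
Require Import Defs.
From mathcomp Require Import all_boot all_algebra all_field.
From mathcomp Require Import boolp zify ring.

Set Implicit Arguments.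
Unset Strict Implicit.
Unset Printing Implicit Defensive.

Import GRing.Theory.
Local Open Scope ring_scope.

(** An algebraic series is D-finite, so [f] satisfies a linear recurrence with
    polynomial coefficients. Consider the germs [w_c : n |-> f (n + c)] for large
    [n] divisible by more and more integers: over the rational functions in [n]
    they span a finite-dimensional space. Multiplicativity gives
    [w_(x b) (n) = f x * w_b (n / x)], so the height of the coordinates of
    [w_(x b)] exceeds that of [w_b] by a constant depending on [x] only. Every
    index is close to a window of consecutive multiples of large pairwise coprime
    [x_i], hence the heights grow slower than any linear function of [c]. For a
    suitable polynomial [Z], the functions [n |-> Z (n + c) * f (n + c)] are then
    linearly dependent over the constants, i.e. [Z f] satisfies a recurrence with
    constant coefficients on [1 + L0 N]. Comparing [f (x n)] with [f x * f n]
    shows that the characteristic roots are roots of unity and then that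
    [f n = n ^ e] for [n] in some class [1 + M N], with [e] an integer. The
    relations among the [w_c] hold for all large multiples of a fixed [L0], which
    yields [f n = n ^ e * chi n] with [chi] periodic. Finally [e < 0] is
    impossible: an algebraic series with rational derivative is rational. *)

(** * Germs along highly divisible integers *)

(** Multiplicativity acts on germs because [n + x * b = x * (n / x + b)], where [n / x + b] is prime
    to [x] once [x ^ 2] divides [n] and [x] is prime to [b]. The obstacle is a count. The recurrence
    alone gives heights growing like [delta * c], and then the roughly [M / L0] constants attached
    to the indices [c <= M] in [1 + L0 N] need not outnumber the coefficient equations they must
    satisfy. With at most [r] coordinates per germ, the slope has to be brought down to
    [1 / (4 r L0)]; dilation by large [x_i] achieves this. Small heights of single germs are not
    enough: the germs also need one denominator, shared up to the factor [Z (n + c)]. It is found by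
    reaching [c] from both ends, forward from 1 and backward from [M], because the poles created on
    the two sides are mostly coprime. *)

Section LinDep.
Variable R : idomainType.

(** Fraction-free elimination on the last coordinate; it serves both over [K] and over [K[z]]. *)
Lemma lin_dep_ord n m (v : 'I_m -> 'I_n -> R) : (n < m)%N ->
  exists g : 'I_m -> R,
    (exists i, g i != 0) /\ forall j, \sum_i g i * v i j = 0.
Proof.
elim: n m v => [|n IHn] [|m] v // nm.
  by exists (fun=> 1); split=> [|[]//]; exists ord0; rewrite oner_neq0.
have [v0|] := pselect (forall i, v i ord_max = 0).
  have [g [g0 gv]] := IHn m.+1 (fun i j => v i (widen_ord (leqnSn n) j)) (ltnW nm).
  exists g; split=> // j; have [jn|nj] := ltnP j n.
    rewrite -[RHS](gv (Ordinal jn)); apply: eq_bigr => i _.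
    by congr (_ * v _ _); apply: val_inj.
  rewrite big1 // => i _; have -> : j = ord_max.
    by apply: val_inj; apply/eqP; rewrite eqn_leq nj -ltnS ltn_ord.
  by rewrite v0 mulr0.
move=> /existsNP[i0 /eqP a0]; set a := v i0 ord_max in a0.
have [g [[k0 gk0] gv]] := IHn m (fun k j =>
  a * v (lift i0 k) (widen_ord (leqnSn n) j)
  - v (lift i0 k) ord_max * v i0 (widen_ord (leqnSn n) j)) nm.
(* The other rows are scaled by the pivot [a] instead of dividing by it, and row [i0] cancels their
   last coordinates. *)
pose g' i := if unlift i0 i is Some k then g k * a
             else - \sum_k g k * v (lift i0 k) ord_max.
exists g'; split.
  by exists (lift i0 k0); rewrite /g' liftK mulf_neq0.
move=> j; rewrite (bigD1_ord i0) //= /g' unlift_none.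
under eq_bigr do rewrite liftK.
rewrite mulNr mulr_suml -sumrN -big_split /=.
have [jn|nj] := ltnP j n.
  rewrite -[RHS](gv (Ordinal jn)); apply: eq_bigr => i _.
  have -> : widen_ord (leqnSn n) (Ordinal jn) = j by apply: val_inj.
  ring.
have -> : j = ord_max.
  by apply: val_inj; apply/eqP; rewrite eqn_leq nj -ltnS ltn_ord.
by rewrite big1 // => i _; rewrite -/a; ring.
Qed.

Lemma lin_dep (I J : finType) (v : I -> J -> R) : (#|J| < #|I|)%N ->
  exists g : I -> R, (exists i, g i != 0) /\ forall j, \sum_i g i * v i j = 0.
Proof.
move=> lt; have [g [[i0 gi0] gv]] :=
  @lin_dep_ord _ _ (fun i j => v (enum_val i) (enum_val j)) lt.
exists (g \o enum_rank); split.
  by exists (enum_val i0); rewrite /= enum_valK.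
move=> j; rewrite -[RHS](gv (enum_rank j)) (reindex (enum_val : 'I_#|I| -> I)) /=; last first.
  by apply: onW_bij; apply: enum_val_bij.
by apply: eq_bigr => i _; rewrite enum_valK enum_rankK.
Qed.

End LinDep.

(** The filter of integers tending to infinity and, in the profinite topology, to 0. It is proper by
    [near_zero_ex]. *)
Definition near_zero (P : nat -> Prop) : Prop :=
  exists L n0, (0 < L)%N /\ forall n, (n0 <= n)%N -> (L %| n)%N -> P n.

Lemma near_zeroT (P : nat -> Prop) : (forall n, P n) -> near_zero P.
Proof. by move=> h; exists 1%N, 0%N. Qed.

Lemma near_zero_mono (P Q : nat -> Prop) :
  (forall n, P n -> Q n) -> near_zero P -> near_zero Q.
Proof. by move=> PQ [L [n0 [L0 h]]]; exists L, n0; split=> // n *; apply/PQ/h. Qed.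

Lemma near_zeroI (P Q : nat -> Prop) :
  near_zero P -> near_zero Q -> near_zero (fun n => P n /\ Q n).
Proof.
move=> [L [n0 [L0 h]]] [L' [n0' [L0' h']]].
exists (L * L')%N, (maxn n0 n0'); split; first by rewrite muln_gt0 L0.
move=> n; rewrite geq_max => /andP[n0n n0n'] LL'; split.
  by apply: h => //; apply: dvdn_trans LL'; apply: dvdn_mulr.
by apply: h' => //; apply: dvdn_trans LL'; apply: dvdn_mull.
Qed.

Lemma near_zero_forall m (P : 'I_m -> nat -> Prop) :
  (forall i, near_zero (P i)) -> near_zero (fun n => forall i, P i n).
Proof.
elim: m P => [|m IHm] P h; first by apply: near_zeroT => n [].
have := near_zeroI (IHm (fun i => P (lift ord0 i)) (fun i => h _)) (h ord0).
apply: near_zero_mono => n [h1 h2] i.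
by case: (unliftP ord0 i) => [j|] ->.
Qed.

Lemma near_zero_ge m : near_zero (fun n => (m <= n)%N).
Proof. by exists 1%N, m. Qed.

Lemma near_zero_dvd d : (0 < d)%N -> near_zero (fun n => (d %| n)%N).
Proof. by move=> d0; exists d, 0%N. Qed.

Lemma near_zero_ex (P : nat -> Prop) m d : (0 < d)%N -> near_zero P ->
  exists n, [/\ (m <= n)%N, (d %| n)%N & P n].
Proof.
move=> d0 hP.
have [L [n0 [L0 h]]] := near_zeroI hP (near_zeroI (near_zero_ge m) (near_zero_dvd d0)).
have [|//|Pn [? ?]] := h (L * n0)%N; last by exists (L * n0)%N.
  exact: leq_pmull.
exact: dvdn_mulr.
Qed.

Lemma near_zero_div (P : nat -> Prop) x : (0 < x)%N ->
  near_zero P -> near_zero (fun n => P (n %/ x)%N).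
Proof.
move=> x0 [L [n0 [L0 h]]]; exists (x * L)%N, (x * n0)%N; split.
  by rewrite muln_gt0 x0.
move=> n le; case/dvdnP=> k nE; rewrite nE mulnCA mulKn // in le *.
by apply: h; [rewrite leq_pmul2l in le|apply: dvdn_mull].
Qed.

(** * Polynomials on the natural numbers, shifts and dispersion *)

Section PolyNat.
Variables (K : fieldType) (charK0 : [pchar K] =i pred0).
Implicit Types p q : {poly K}.

Lemma natr_eq0_char0 n : (n%:R == 0 :> K) = (n == 0%N).
Proof. by move/pcharf0P: charK0 => ->. Qed.

Lemma natr_inj_char0 : injective (fun n : nat => n%:R : K).
Proof.
move=> m n; wlog le : m n / (m <= n)%N => [hw mn|].
  have [le|/ltnW le] := leqP m n; first exact: hw.
  by apply/esym; apply: hw.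
move=> /eqP; rewrite eq_sym -subr_eq0 -natrB // natr_eq0_char0 subn_eq0 => le'.
by apply/eqP; rewrite eqn_leq le.
Qed.

Lemma poly_nat_neq0 (p : {poly K}) : p != 0 ->
  exists n0, forall n, (n0 <= n)%N -> p.[n%:R] != 0.
Proof.
have [k] := ubnP (size p); elim: k p => // k IHk p; rewrite ltnS => sp p0.
have [[m rm]|] := pselect (exists m, root p m%:R); last first.
  by move=> /forallNP nr; exists 0%N => n _; apply/negP => /nr.
move/factor_theorem: rm => [q pq]; have q0 : q != 0.
  by apply: contraNneq p0 => q0; rewrite pq q0 mul0r.
have [|n0 h] := IHk q _ q0.
  by rewrite pq size_Mmonic ?monicXsubC // size_XsubC addn2 in sp.
exists (maxn n0 m.+1) => n; rewrite geq_max => /andP[n0n mn].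
rewrite pq hornerM !hornerE mulf_neq0 ?h // subr_eq0.
by apply/negP => /eqP/natr_inj_char0 nm; rewrite nm ltnn in mn.
Qed.

Lemma poly_near_zero_neq0 (p : {poly K}) : p != 0 ->
  near_zero (fun n => p.[n%:R] != 0).
Proof. by move=> /poly_nat_neq0[n0 h]; exists 1%N, n0; split=> // n /h. Qed.

Lemma poly_near_zero_eq0 (p : {poly K}) :
  near_zero (fun n => p.[n%:R] = 0) -> p = 0.
Proof.
move=> h; apply/eqP; apply: contrapT => /negP/poly_near_zero_neq0 h'.
have [n [_ _ [e]]] := near_zero_ex 0 (ltn0Sn 0) (near_zeroI h h').
by rewrite e eqxx.
Qed.

Definition shiftp (c : nat) (p : {poly K}) := p \Po ('X + c%:R%:P).

Lemma size_XaddC (c : K) : size ('X + c%:P) = 2%N.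
Proof. by rewrite -[c]opprK polyCN size_XsubC. Qed.

Lemma horner_shiftp c p n : (shiftp c p).[n%:R] = p.[(n + c)%:R].
Proof. by rewrite horner_comp !hornerE natrD. Qed.

Lemma size_shiftp c p : size (shiftp c p) = size p.
Proof. by rewrite size_comp_poly2 // size_XaddC. Qed.

Lemma shiftp_eq0 c p : (shiftp c p == 0) = (p == 0).
Proof. by rewrite -!size_poly_eq0 size_shiftp. Qed.

Lemma shiftpD c d p : shiftp c (shiftp d p) = shiftp (c + d) p.
Proof.
rewrite /shiftp -comp_polyA comp_polyD comp_polyX comp_polyC -addrA.
by rewrite -polyCD -natrD.
Qed.

Lemma shiftpM c p q : shiftp c (p * q) = shiftp c p * shiftp c q.
Proof. exact: comp_polyM. Qed.

(** Equal sizes and leading coefficients turn divisibility into [p = shiftp m p]. Then [p] takes the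
    value [p.[0]] at every multiple of [m], so it is constant in characteristic 0. *)
Lemma shiftp_ndvd p m : (1 < size p)%N -> (0 < m)%N -> ~~ (p %| shiftp m p).
Proof.
move=> sp m0; have p0 : p != 0 by rewrite -size_poly_gt0 ltnW.
apply/negP => dv; have : p %= shiftp m p.
  by rewrite -dvdp_size_eqp // size_shiftp.
move=> /eqpfP; rewrite lead_coef_comp ?size_XaddC //.
have lcX : lead_coef ('X + m%:R%:P : {poly K}) = 1.
  by rewrite lead_coefDl ?lead_coefX // size_polyX size_polyC; case: eqP.
rewrite lcX expr1n mulr1 divff ?lead_coef_eq0 // scale1r => pE.
have pP k : p.[(k * m)%:R] = p.[0].
  elim: k => // k IHk; rewrite mulSnr natrD -IHk [in RHS]pE.
  by rewrite horner_comp !hornerE.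
suff : p - p.[0]%:P = 0.
  by move/subr0_eq => pc; rewrite pc size_polyC in sp; case: (_ != _) sp.
apply: poly_near_zero_eq0; exists m, 0%N; split=> // n _ /dvdnP[k ->].
by rewrite !hornerE pP subrr.
Qed.

(** A common factor comes from two roots differing by [k], and there are finitely many pairs of
    roots. The induction on sizes works with factors instead of roots and so stays over [K]. *)
Lemma dispersion (p q : {poly K}) : p != 0 -> q != 0 ->
  exists s, forall k, (s <= k)%N -> coprimep p (shiftp k q).
Proof.
have [N] := ubnP (size p + size q); elim: N p q => // N IHN p q.
rewrite ltnS => sN p0 q0.
have split (g : {poly K}) : (1 < size g < size p)%N -> g %| p ->
    exists s, forall k, (s <= k)%N -> coprimep p (shiftp k q).
  move=> /andP[g1 gp] /dvdpP[h pE].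
  have h0 : h != 0 by apply: contraNneq p0 => h0; rewrite pE h0 mul0r.
  have g0 : g != 0 by rewrite -size_poly_gt0 ltnW.
  have sgh : size p = (size h + size g).-1 by rewrite pE size_mul.
  have [|//|//|s1 h1] := IHN g q; first by lia.
  have [|//|//|s2 h2] := IHN h q; first by lia.
  exists (maxn s1 s2) => k; rewrite geq_max => /andP[k1 k2].
  by rewrite pE coprimepMl h1 // h2.
have [allc|] := pselect (forall k, coprimep p (shiftp k q)); first by exists 0%N.
move=> /existsNP[k0 /negP]; set g := gcdp p (shiftp k0 q) => ncop.
have gp : g %| p by apply: dvdp_gcdl.
have g1 : (1 < size g)%N.
  rewrite ltn_neqAle eq_sym ncop size_poly_gt0.
  by apply: contraNneq p0 => g0; move: gp; rewrite g0 dvd0p.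
have [sgp|] := ltnP (size g) (size p); first by apply: (split g); rewrite ?g1.
(* Now all of [p] divides the shift, so [q] is a cofactor times a translate of [p], and the
   self-shifts of [p] decide. *)
move=> spg; have pq : p %| shiftp k0 q.
  apply: dvdp_trans (dvdp_gcdr p _).
  suff /eqp_dvdl -> : p %= g by [].
  rewrite eqp_sym -dvdp_size_eqp // eqn_leq spg andbT; exact: dvdp_leq.
pose unsh (r : {poly K}) := r \Po ('X - k0%:R%:P).
have unshK r : shiftp k0 (unsh r) = r.
  rewrite /unsh /shiftp -comp_polyA comp_polyB comp_polyX comp_polyC addrK.
  by rewrite comp_polyXr.
have unshK' r : unsh (shiftp k0 r) = r.
  rewrite /unsh /shiftp -comp_polyA comp_polyD comp_polyX comp_polyC subrK.
  by rewrite comp_polyXr.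
have szu r : size (unsh r) = size r by rewrite -[in RHS](unshK r) size_shiftp.
case/dvdpP: pq => h hE; have qE : q = unsh h * unsh p.
  by rewrite /unsh -comp_polyM -hE -/(unsh _) unshK'.
have h0 : h != 0 by apply: contraNneq q0 => h0; rewrite qE h0 /unsh comp_poly0 mul0r.
have sq : size q = (size h + size p).-1.
  by rewrite qE size_mul ?szu // -size_poly_eq0 szu size_poly_eq0.
have sh0 : (0 < size h)%N by rewrite size_poly_gt0.
have sp1 : (1 < size p)%N by apply: leq_trans g1 _; apply: dvdp_leq.
have [self|] := pselect (forall m, (0 < m)%N -> coprimep p (shiftp m p)).
  have uh0 : unsh h != 0 by rewrite -size_poly_eq0 szu size_poly_eq0.
  have [|//|//|s1 h1] := IHN p (unsh h); first by rewrite szu; lia.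
  exists (maxn s1 k0.+1) => k; rewrite geq_max => /andP[k1 k2].
  rewrite qE shiftpM coprimepMr h1 //=.
  by rewrite -(subnK (ltnW k2)) -shiftpD unshK self // subn_gt0.
(* By [shiftp_ndvd] the gcd of [p] with its own shift is a proper factor of [p]. *)
move=> /existsNP[m /not_implyP[m0 /negP ncop']].
apply: (split (gcdp p (shiftp m p))); last exact: dvdp_gcdl.
have le := dvdp_leq p0 (dvdp_gcdl p (shiftp m p)).
apply/andP; split.
  rewrite ltn_neqAle eq_sym ncop' size_poly_gt0.
  by apply: contraNneq p0 => g0; move: (dvdp_gcdl p (shiftp m p)); rewrite g0 dvd0p.
rewrite ltn_neqAle le andbT; apply/negP => e.
have : p %| shiftp m p.
  apply: dvdp_trans (dvdp_gcdr p _).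
  suff /eqp_dvdl -> : p %= gcdp p (shiftp m p) by [].
  by rewrite eqp_sym -dvdp_size_eqp // dvdp_gcdl.
by apply/negP/shiftp_ndvd.
Qed.

End PolyNat.

(** * Heights of the germs of a multiplicative recurrent function *)

Lemma size_sum_le (R : nzRingType) (I : finType) (P : pred I) (F : I -> {poly R}) h :
  (forall i, P i -> (size (F i) <= h)%N) -> (size (\sum_(i | P i) F i)%R <= h)%N.
Proof.
by move=> hF; apply: leq_trans (size_sum _ _ _) _; apply/bigmax_leqP.
Qed.

Lemma size_mul_le (R : nzRingType) (p q : {poly R}) h k :
  (size p <= h)%N -> (size q <= k)%N -> (size (p * q)%R <= h + k)%N.
Proof.
move=> ph qk; apply: leq_trans (size_polyMleq _ _) _.
exact: leq_trans (leq_pred _) (leq_add ph qk).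
Qed.

Lemma size_prod_le (R : nzRingType) (I : finType) (P : pred I) (F : I -> {poly R}) h :
  (forall i, (size (F i) <= h)%N) -> (size (\prod_(i | P i) F i)%R <= (h * #|I|).+1)%N.
Proof.
move=> hF; apply: leq_trans (size_poly_prod_leq _ _) _.
apply: leq_trans (leq_subr _ _) _; rewrite ltnS.
apply: leq_trans (_ : \sum_(i | P i) h <= _)%N; first by apply: leq_sum.
by rewrite sum_nat_const mulnC leq_mul2l max_card orbT.
Qed.

(** Euclid's construction: [x i] is [P i + 1], and [P i] is divisible by the factorial of [m] and by
    every earlier [x j]. *)
Lemma coprime_family m b : exists x : nat -> nat, forall i,
  [/\ (b < x i)%N, coprime (x i) m`! & forall j, (j < i)%N -> coprime (x i) (x j)].
Proof.
pose P := fix P i := if i is j.+1 then (P j * (P j).+1)%N else (m`! * b.+1)%N.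
have PS j k : (j <= k)%N -> (P j %| P k)%N.
  elim: k => [|k IHk]; first by rewrite leqn0 => /eqP ->.
  by rewrite leq_eqVlt ltnS => /orP[/eqP->//|/IHk h]; apply: dvdn_mulr.
have P0 i : (0 < P i)%N.
  by elim: i => [|i IHi] /=; rewrite muln_gt0 ?fact_gt0 ?IHi.
exists (fun i => (P i).+1) => i; split.
- have /(dvdn_leq (P0 i)) := PS 0%N i (leq0n i).
  by rewrite ltnS; apply: leq_trans; rewrite (leq_trans (leqnSn b)) // leq_pmull ?fact_gt0.
- have d : (m`! %| P i)%N by apply: dvdn_trans (PS 0%N i _) => //; apply: dvdn_mulr.
  by apply: coprime_dvdr d _; apply: coprimeSn.
- move=> j ji; have d : ((P j).+1 %| P i)%N.
    by apply: dvdn_trans (PS _ _ ji) => /=; apply: dvdn_mull.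
  by apply: coprime_dvdr d _; apply: coprimeSn.
Qed.

Lemma crt_window m (x : nat -> nat) : (forall i, (1 < x i)%N) ->
  (forall i j, (j < i)%N -> coprime (x i) (x j)) ->
  exists X c0, (0 < X)%N /\ forall c i, (i < m)%N -> c = c0 %[mod X] ->
    exists b, (c + i = x i * b)%N /\ coprime (x i) b.
Proof.
move=> x1 cop.
(* The residue [x i] modulo [x i ^ 2] makes the quotient [b] congruent to 1 modulo [x i], hence
   prime to it. *)
suff [c0 hc0] : exists c0, forall c i, (i < m)%N ->
    c = c0 %[mod \prod_(j < m) x j ^ 2] -> c + i = x i %[mod x i ^ 2].
  exists (\prod_(j < m) x j ^ 2)%N, c0; split.
    by rewrite prodn_gt0 // => j; rewrite expn_gt0 ltnW.
  move=> c i im /(hc0 c i im) e; exists ((c + i) %/ x i ^ 2 * x i + 1)%N.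
  split; last by rewrite -coprime_modr modnMDl coprime_modr coprimen1.
  rewrite {1}(divn_eq (c + i) (x i ^ 2)) e modn_small.
    by rewrite expnS expn1; ring.
  by rewrite -{1}(expn1 (x i)) ltn_exp2l.
elim: m => [|m [c0 IHm]]; first by exists 0%N.
set X := (\prod_(j < m) x j ^ 2)%N in IHm.
have copX : coprime X (x m ^ 2).
  apply: (big_ind (fun y => coprime y (x m ^ 2))) => [|y z hy hz|j _].
  - exact: coprime1n.
  - by rewrite coprimeMl hy.
  - by rewrite coprimeXl // coprimeXr // coprime_sym cop.
(* The second residue is [x m - m], written without subtraction. *)
have [y [yX yx]] : exists y, y = c0 %[mod X] /\
    y = x m + m * (x m ^ 2 - 1) %[mod x m ^ 2].
  by exists (chinese X (x m ^ 2) c0 (x m + m * (x m ^ 2 - 1)));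
    split; [apply: chinese_modl|apply: chinese_modr].
exists y => c i im; rewrite big_ord_recr /= -/X => e.
rewrite ltnS leq_eqVlt in im; case/orP: im => [/eqP->|im].
  have := congr1 (modn^~ (x m ^ 2)%N) e.
  rewrite !modn_dvdm; [|exact: dvdn_mull|exact: dvdn_mull].
  rewrite yx => e'; rewrite -modnDml e' modnDml -addnA -mulnSr subn1.
  by rewrite prednK ?expn_gt0 ?(ltnW (x1 m)) // addnC modnMDl.
apply: IHm im _; have := congr1 (modn^~ X) e.
by rewrite !modn_dvdm; [rewrite yX|exact: dvdn_mulr|exact: dvdn_mulr].
Qed.

Section Germs.
Variables (K : fieldType) (charK0 : [pchar K] =i pred0) (f : nat -> K) (r : nat).

Section Basis.
Variable B : {set 'I_r}.

(** Indices start at 1 because dilation by [x > 1] needs the index prime to [x], which 0 never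
    is. *)
Definition comb (N : 'I_r -> {poly K}) (n : nat) : K :=
  \sum_(i in B) (N i).[n%:R] * f (n + i.+1)%N.

Definition germ_free : Prop :=
  forall N, near_zero (fun n => comb N n = 0) -> forall i, i \in B -> N i = 0.

Definition rep (Q : {poly K}) (c : nat) (N : 'I_r -> {poly K}) : Prop :=
  near_zero (fun n => Q.[n%:R] * f (n + c)%N = comb N n).

Lemma combM P N n : comb (fun i => P * N i) n = P.[n%:R] * comb N n.
Proof.
rewrite /comb mulr_sumr; apply: eq_bigr => i _; rewrite hornerM; ring.
Qed.

Lemma comb_sum (I : finType) (N : I -> 'I_r -> {poly K}) n :
  comb (fun k => \sum_i N i k) n = \sum_i comb (N i) n.
Proof.
rewrite /comb exchange_big /=; apply: eq_bigr => i _.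
by rewrite horner_sum mulr_suml.
Qed.

Lemma combD N N' n : comb (fun i => N i + N' i) n = comb N n + comb N' n.
Proof.
by rewrite /comb -big_split /=; apply: eq_bigr => i _; rewrite hornerD mulrDl.
Qed.

Lemma combN N n : comb (fun i => - N i) n = - comb N n.
Proof.
by rewrite /comb -sumrN; apply: eq_bigr => i _; rewrite hornerN mulNr.
Qed.

Lemma rep_mul P Q c N : rep Q c N -> rep (P * Q) c (fun i => P * N i).
Proof.
by apply: near_zero_mono => n e; rewrite combM -e hornerM mulrA.
Qed.

End Basis.

Lemma germ_basis_exists : exists B, germ_free B /\
  forall j : 'I_r, exists (Q : {poly K}) N, Q != 0 /\ rep B Q j.+1 N.
Proof.
have free0 : `[< germ_free set0 >] by apply/asboolP => N _ i; rewrite inE.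
have [B /maxsetP[/asboolP freeB maxB] _] := maxset_exists
  (P := fun B => `[< germ_free B >]) free0.
exists B; split=> // j; have [jB|jB] := boolP (j \in B).
  exists 1, (fun i => (i == j)%:R); split; first exact: oner_neq0.
  apply: near_zeroT => n; rewrite /comb (bigD1 j) //= eqxx big1 ?addr0 ?hornerE //.
  by move=> i /andP[_ /negPf ->]; rewrite hornerE mul0r.
have : ~ germ_free (j |: B).
  move=> /asboolP fr; have jB' := maxB _ fr (subsetUr _ _).
  by move: jB; rewrite -jB' setU11.
move=> /existsNP[N /not_implyP[hN /existsNP[i /not_implyP[iB /eqP Ni]]]].
have combE n : comb (j |: B) N n = (N j).[n%:R] * f (n + j.+1)%N + comb B N n.
  by rewrite /comb big_setU1.
have Nj : N j != 0.
  apply/negP => /eqP Nj; case/setU1P: iB => [ij|iB]; first by rewrite ij Nj eqxx in Ni.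
  move: Ni; rewrite (freeB N) ?eqxx //; apply: near_zero_mono hN => n.
  by rewrite combE Nj hornerE mul0r add0r.
exists (N j), (fun i => - N i); split=> //; apply: near_zero_mono hN => n.
by rewrite combE combN => /eqP; rewrite addr_eq0 => /eqP.
Qed.

Section Recurrence.
Variables (a : nat -> {poly K}) (n1 : nat).
Hypothesis f_rec : forall n, (n1 <= n)%N ->
  \sum_(i < r.+1) (a i).[n%:R] * f (n + i)%N = 0.
Hypothesis a_hi : a r != 0.

Lemma f_rec_hi n : (n1 <= n)%N ->
  (a r).[n%:R] * f (n + r)%N = - \sum_(i < r) (a i).[n%:R] * f (n + i)%N.
Proof.
by move=> /f_rec; rewrite big_ord_recr /= addrC => /eqP; rewrite addr_eq0 => /eqP.
Qed.

Lemma f_rec_lo n : (n1 <= n)%N ->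
  (a 0).[n%:R] * f n = - \sum_(i < r) (a i.+1).[n%:R] * f (n + i.+1)%N.
Proof.
move=> /f_rec; rewrite big_ord_recl /= addn0 => /eqP; rewrite addr_eq0 => /eqP ->.
by congr (- _); apply: eq_bigr.
Qed.

Variable B : {set 'I_r}.
Hypothesis B_free : germ_free B.
Hypothesis B_span : forall j : 'I_r, exists (Q : {poly K}) N, Q != 0 /\ rep B Q j.+1 N.
Local Notation comb := (comb B).
Local Notation rep := (rep B).

Lemma rep_unique Q Q' c N N' : rep Q c N -> rep Q' c N' ->
  forall i, i \in B -> Q' * N i = Q * N' i.
Proof.
move=> h h' i iB; apply/eqP; rewrite -subr_eq0; apply/eqP.
apply: (B_free (N := fun i => Q' * N i - Q * N' i)) => //.
apply: near_zero_mono (near_zeroI h h') => n [e e'].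
by rewrite combD combN !combM -e -e' mulrCA subrr.
Qed.

Lemma uniform_rep : exists L0 n0, (0 < L0)%N /\ forall c, (0 < c)%N ->
  exists Q N, forall n, (n0 <= n)%N -> (L0 %| n)%N ->
    Q.[n%:R] != 0 /\ Q.[n%:R] * f (n + c)%N = comb N n.
Proof.
have /choice[Q /choice[N hQN]] := B_span.
have [m0 hm0] := poly_nat_neq0 charK0 a_hi.
have [L0 [n0 [L00 h]]] := near_zeroI (near_zeroI (near_zero_ge n1) (near_zero_ge m0))
  (near_zero_forall (fun j => near_zeroI (poly_near_zero_neq0 charK0 (hQN j).1) (hQN j).2)).
exists L0, n0; split=> //; elim/ltn_ind => c IHc c0.
have [cr|rc] := leqP c r.
  have cr' : (c.-1 < r)%N by rewrite prednK.
  exists (Q (Ordinal cr')), (N (Ordinal cr')) => n n0n L0n.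
  have [_ /(_ (Ordinal cr'))[hq hr]] := h n n0n L0n; split=> //.
  by rewrite /= prednK // in hr.
have IH (i : 'I_r) : exists QN : {poly K} * ('I_r -> {poly K}),
    forall n, (n0 <= n)%N -> (L0 %| n)%N ->
    QN.1.[n%:R] != 0 /\ QN.1.[n%:R] * f (n + (c - r + i))%N = comb QN.2 n.
  have [||Q' [N' hQ']] := IHc (c - r + i)%N; last by exists (Q', N').
  - by have := ltn_ord i; lia.
  - by lia.
have [QN hQN'] := choice IH.
pose P i := \prod_(j | j != i) (QN j).1.
exists (shiftp (c - r) (a r) * \prod_i (QN i).1),
  (fun k => \sum_(i < r) - (shiftp (c - r) (a i) * P i) * (QN i).2 k).
move=> n n0n L0n; have [[n1n m0n] _] := h n n0n L0n.
rewrite hornerM horner_shiftp horner_prod; split.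
  rewrite mulf_neq0 //; first by apply: hm0; apply: leq_trans m0n (leq_addr _ _).
  by apply/prodf_neq0 => i _; have [] := hQN' i n n0n L0n.
have -> : (n + c = n + (c - r) + r)%N by lia.
rewrite mulrAC f_rec_hi; last by apply: leq_trans n1n (leq_addr _ _).
rewrite comb_sum mulNr mulr_suml -sumrN; apply: eq_bigr => i _.
rewrite combM hornerN hornerM horner_shiftp mulNr; congr (- _).
rewrite -(hQN' i n n0n L0n).2 addnA (bigD1 i) //= horner_prod; ring.
Qed.

(** After clearing denominators the relation is a combination of basis germs, whose coefficients
    vanish identically by freeness. The relation thus holds wherever the denominators of
    [uniform_rep] are nonzero. *)
Lemma uniform_relation : exists L0 n0, (0 < L0)%N /\
  forall (I : finType) (c : I -> nat) (l : I -> {poly K}),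
  (forall i, (0 < c i)%N) ->
  near_zero (fun n => \sum_i (l i).[n%:R] * f (n + c i)%N = 0) ->
  forall n, (n0 <= n)%N -> (L0 %| n)%N -> \sum_i (l i).[n%:R] * f (n + c i)%N = 0.
Proof.
have [L0 [n0 [L00 h]]] := uniform_rep; exists L0, n0; split=> // I c l c0 hl.
have IH (i : I) : exists QN : {poly K} * ('I_r -> {poly K}),
    forall n, (n0 <= n)%N -> (L0 %| n)%N ->
    QN.1.[n%:R] != 0 /\ QN.1.[n%:R] * f (n + c i)%N = comb QN.2 n.
  by have [Q [N hQ]] := h (c i) (c0 i); exists (Q, N).
have {h IH}[QN hQN] := choice IH.
pose P i := \prod_(j | j != i) (QN j).1.
pose M k := \sum_i (l i * P i) * (QN i).2 k.
have MP n : (n0 <= n)%N -> (L0 %| n)%N ->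
    comb M n = (\prod_i (QN i).1).[n%:R] * \sum_i (l i).[n%:R] * f (n + c i)%N.
  move=> n0n L0n; rewrite comb_sum mulr_sumr; apply: eq_bigr => i _.
  rewrite combM hornerM -(hQN i n n0n L0n).2 (bigD1 i) //= hornerM; ring.
have M0 : forall i, i \in B -> M i = 0.
  apply: B_free; apply: near_zero_mono (near_zeroI hl (near_zeroI
    (near_zero_ge n0) (near_zero_dvd L00))) => n [e [n0n L0n]].
  by rewrite MP // e mulr0.
move=> n n0n L0n; have /eqP := MP n n0n L0n.
rewrite /comb big1 => [|i iB]; last by rewrite M0 // hornerE mul0r.
rewrite eq_sym mulf_eq0 horner_prod => /orP[|/eqP //].
by move=> /prodf_eq0[i _]; rewrite (negPf (hQN i n n0n L0n).1).
Qed.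

Lemma rep_next Q c (N : 'I_r -> 'I_r -> {poly K}) :
  (forall i : 'I_r, rep Q (c + i) (N i)) ->
  rep (shiftp c (a r) * Q) (c + r)
      (fun k => \sum_(i < r) - shiftp c (a i) * N i k).
Proof.
move=> /near_zero_forall/(near_zeroI (near_zero_ge n1)); apply: near_zero_mono.
move=> n [n1n h]; rewrite hornerM horner_shiftp mulrAC addnA f_rec_hi; last first.
  exact: leq_trans n1n (leq_addr _ _).
rewrite comb_sum mulNr mulr_suml -sumrN; apply: eq_bigr => i _.
by rewrite combM -h hornerN horner_shiftp addnA; ring.
Qed.

Lemma rep_prev Q c (N : 'I_r -> 'I_r -> {poly K}) :
  (forall i : 'I_r, rep Q (c + i.+1) (N i)) ->
  rep (shiftp c (a 0) * Q) c
      (fun k => \sum_(i < r) - shiftp c (a i.+1) * N i k).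
Proof.
move=> /near_zero_forall/(near_zeroI (near_zero_ge n1)); apply: near_zero_mono.
move=> n [n1n h]; rewrite hornerM horner_shiftp mulrAC f_rec_lo; last first.
  exact: leq_trans n1n (leq_addr _ _).
rewrite comb_sum mulNr mulr_suml -sumrN; apply: eq_bigr => i _.
by rewrite combM -h hornerN horner_shiftp addnA; ring.
Qed.

Definition rep_le h Q c :=
  exists N : 'I_r -> {poly K}, (forall i, (size (N i) <= h)%N) /\ rep Q c N.

Definition height_le h c :=
  exists Q : {poly K}, [/\ Q != 0, (size Q <= h)%N & rep_le h Q c].

(** With a denominator shared by the window, a recurrence step costs only [delta]; separate
    denominators would have to be multiplied together at every step. *)
Definition window_le h c :=
  exists Q : {poly K}, [/\ Q != 0, (size Q <= h)%N &
    forall i : 'I_r, rep_le h Q (c + i)].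

Definition delta := (\max_(i < r.+1) size (a i))%N.

Lemma size_a_le i : (i <= r)%N -> (size (a i) <= delta)%N.
Proof.
by rewrite -ltnS => ir; apply: (@leq_bigmax _ (fun i : 'I_r.+1 => size (a i)) (Ordinal ir)).
Qed.

Lemma window_le_step h c : window_le h c -> window_le (delta + h) c.+1.
Proof.
move=> [Q [Q0 sQ hQ]]; exists (shiftp c (a r) * Q); split.
- by rewrite mulf_neq0 // shiftp_eq0.
- by rewrite size_mul_le // size_shiftp size_a_le.
move=> i; have [ir|ri] := ltnP i.+1 r.
  have [N [sN hN]] := hQ (Ordinal ir); exists (fun k => shiftp c (a r) * N k).
  split=> [k|]; first by rewrite size_mul_le // size_shiftp size_a_le.
  by rewrite addSnnS; apply: rep_mul.
have [N hN] := choice hQ.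
have -> : (c.+1 + i = c + r)%N by have := ltn_ord i; lia.
exists (fun k => \sum_(i < r) - shiftp c (a i) * N i k); split=> [k|].
  apply: size_sum_le => j _; rewrite mulNr size_polyN size_mul_le ?size_shiftp //.
    by rewrite size_a_le // ltnW.
  exact: (hN j).1.
by apply: rep_next => j; apply: (hN j).2.
Qed.

Lemma window_le_add h c j : window_le h c -> window_le (j * delta + h) (c + j).
Proof.
elim: j => [|j IHj] h0; first by rewrite addn0.
by rewrite addnS mulSn -addnA; apply/window_le_step/IHj.
Qed.

Lemma window_le_of_heights h c : (forall i : 'I_r, height_le h (c + i)) ->
  window_le (h + (h * r).+1) c.
Proof.
move=> /choice[Q hQ]; have sP (P : pred 'I_r) : (size (\prod_(i | P i) Q i)%R <= (h * r).+1)%N.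
  by rewrite -[X in (_ * X)%N]card_ord; apply: size_prod_le => i; have [] := hQ i.
exists (\prod_i Q i); split.
- by apply/prodf_neq0 => i _; have [] := hQ i.
- by apply: leq_trans (sP _) (leq_addl _ _).
move=> i; have [_ _ [N [sN hN]]] := hQ i.
exists (fun k => (\prod_(j | j != i) Q j) * N k); split=> [k|].
  by rewrite addnC size_mul_le.
by rewrite (bigD1 i) //= mulrC; apply: rep_mul.
Qed.

Lemma window_le_1 : exists h, window_le h 1.
Proof.
have h (j : 'I_r) : exists h, height_le h (1 + j).
  have [Q [N [Q0 hQ]]] := B_span j.
  exists (size Q + \sum_i size (N i))%N, Q; split; rewrite ?leq_addr //.
  exists N; split=> // i.
  by apply: leq_trans (leq_addl _ _); rewrite (bigD1 i) //= leq_addr.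
have [g hg] := choice h.
exists (\sum_i g i + ((\sum_i g i) * r).+1)%N; apply: window_le_of_heights => i.
have [Q [Q0 sQ [N [sN hN]]]] := hg i.
have le : (g i <= \sum_i g i)%N by rewrite (bigD1 i) //= leq_addr.
exists Q; split=> //; first exact: leq_trans le.
by exists N; split=> // k; apply: leq_trans le.
Qed.

Lemma height_le_linear : exists h0, forall c, (0 < c)%N ->
  window_le (c * delta + h0) c.
Proof.
have [h0 h] := window_le_1; exists h0 => c c0.
have [Q [Q0 sQ hQ]] := window_le_add c.-1 h; rewrite add1n prednK // in hQ.
have le : (c.-1 * delta + h0 <= c * delta + h0)%N by rewrite leq_add2r leq_mul2r leq_pred orbT.
exists Q; split=> //; first exact: leq_trans le.
by move=> i; have [N [sN hN]] := hQ i; exists N; split=> // k; apply: leq_trans le.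
Qed.

Lemma height_le_mono h h' c : (h <= h')%N -> height_le h c -> height_le h' c.
Proof.
move=> le [Q [Q0 sQ [N [sN hN]]]]; exists Q; split=> //; first exact: leq_trans le.
by exists N; split=> // i; apply: leq_trans le.
Qed.

Definition scalep (x : nat) (p : {poly K}) := p \Po (x%:R^-1 *: 'X).

Lemma size_scalep x p : (0 < x)%N -> size (scalep x p) = size p.
Proof.
move=> x0; rewrite size_comp_poly2 // size_scale ?size_polyX //.
by rewrite invr_eq0 natr_eq0_char0 // -lt0n.
Qed.

Lemma horner_scalep x p n : (0 < x)%N -> (x %| n)%N ->
  (scalep x p).[n%:R] = p.[(n %/ x)%:R].
Proof.
move=> x0 /dvdnP[k ->]; rewrite horner_comp !hornerE mulnK // natrM.
by rewrite mulrC mulfK // natr_eq0_char0 // -lt0n.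
Qed.

Hypothesis f_mult : forall m n : nat, (0 < m)%N -> (0 < n)%N -> coprime m n ->
  f (m * n)%N = f m * f n.

(** The representation of [b], taken at [n / x], involves the [f (n / x + i.+1)]. Multiplication by
    [f x] turns them into [f (n + x * i.+1)], as [x] is prime to [i.+1], and these finitely many
    germs are re-expanded in the basis at a cost [C] fixed by [x]. *)
Lemma height_le_dilate x : (0 < x)%N -> (forall i : 'I_r, coprime x i.+1) ->
  exists C, forall h b, (0 < b)%N -> coprime x b ->
    height_le h b -> height_le (h + C) (x * b).
Proof.
move=> x0 copx; have [h0 hlin] := height_le_linear.
have reps (i : 'I_r) : exists QN : {poly K} * ('I_r -> {poly K}),
    QN.1 != 0 /\ rep QN.1 (x * i.+1) QN.2.
  have [|Q [Q0 _ hQ]] := hlin (x * i.+1)%N; first by rewrite muln_gt0 x0.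
  have r0 : (0 < r)%N by apply: leq_ltn_trans (ltn_ord i).
  by have [N [_ hN]] := hQ (Ordinal r0); exists (Q, N); rewrite addn0 in hN.
have [QN hQN] := choice reps.
pose P i := \prod_(j | j != i) (QN j).1.
pose C := (size (\prod_i (QN i).1)%R + \sum_i \sum_k size (P i * (QN i).2 k)%R)%N.
exists C => h b b0 copb [Q [Q0 sQ [N [sN hN]]]].
exists (scalep x Q * \prod_i (QN i).1); split.
- rewrite mulf_neq0 //; first by rewrite -size_poly_eq0 size_scalep // size_poly_eq0.
  by apply/prodf_neq0 => i _; have [] := hQN i.
- by rewrite size_mul_le ?size_scalep // leq_addr.
exists (fun k => \sum_(i in B) (scalep x (N i)) * (P i * (QN i).2 k)); split.
  move=> k; apply: size_sum_le => i _; rewrite size_mul_le ?size_scalep //.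
  apply: leq_trans (leq_addl _ _).
  by rewrite (bigD1 i) //= (bigD1 k) //= -addnA leq_addr.
have xx0 : (0 < x * x)%N by rewrite muln_gt0 x0.
have := near_zeroI (near_zeroI (near_zero_div x0 hN) (near_zero_dvd xx0))
  (near_zero_forall (fun i => (hQN i).2)).
apply: near_zero_mono => n [[e xxn] hi].
have xn : (x %| n)%N by apply: dvdn_trans xxn; apply: dvdn_mulr.
have dil c : (0 < c)%N -> coprime x c -> f (n + x * c)%N = f x * f (n %/ x + c)%N.
  move=> c0 copc; rewrite -f_mult ?addn_gt0 ?c0 ?orbT //.
    by rewrite mulnDr (mulnC x (n %/ x)%N) divnK.
  case/dvdnP: xxn => k ->; rewrite mulnA mulnK // -coprime_modr modnMDl.
  by rewrite coprime_modr.
rewrite hornerM (horner_scalep _ x0 xn) dil //.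
transitivity (f x * (\prod_i (QN i).1).[n%:R] * (Q.[(n %/ x)%:R] * f (n %/ x + b)%N)).
  by ring.
rewrite e /comb.
under [RHS]eq_bigr do rewrite horner_sum mulr_suml.
rewrite [RHS]exchange_big /= mulr_sumr; apply: eq_bigr => i iB.
transitivity ((N i).[(n %/ x)%:R] * (\prod_i0 (QN i0).1).[n%:R] * f (n + x * i.+1)%N).
  by rewrite dil //; ring.
rewrite (bigD1 i) //= hornerM.
transitivity ((N i).[(n %/ x)%:R] * (P i).[n%:R] * ((QN i).1.[n%:R] * f (n + x * i.+1)%N)).
  by rewrite /P; ring.
rewrite hi /comb mulr_sumr; apply: eq_bigr => k _.
by rewrite !hornerM (horner_scalep _ x0 xn); ring.
Qed.

(* Windows whose entries are exact multiples of the [x i] inherit the height of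
   indices [x i] times smaller, so heights grow slower than any linear rate. *)
Lemma window_le_sublinear e : (0 < r)%N -> exists beta, forall c, (0 < c)%N ->
  exists h, (e * h <= c + beta)%N /\ window_le h c.
Proof.
move=> r0; have [h0 hlin] := height_le_linear.
(* A dilated entry has height about [delta * c / x i], and gathering a window multiplies it by
   [r.+1]. The bound [x i > k] keeps [e] times the result below [c] up to a constant. *)
pose k := (e * r.+1 * delta)%N.
have [x hx] := coprime_family r (maxn k 1).
have xk i : (k < x i)%N by have [+ _ _] := hx i; rewrite gtn_max => /andP[].
have x1 i : (1 < x i)%N by have [+ _ _] := hx i; rewrite gtn_max => /andP[].
have x0 i : (0 < x i)%N := ltnW (x1 i).
have xcop i (j : 'I_r) : coprime (x i) j.+1.
  have [_ + _] := hx i; apply: coprime_dvdr.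
  by apply: dvdn_fact; rewrite /= ltn_ord.
have [|X [c0 [X0 hX]]] := @crt_window r x x1; first by move=> i; have [] := hx i.
have [C hC] := choice (fun i : 'I_r => height_le_dilate (x0 i) (xcop i)).
pose Cs := (\sum_i C i)%N.
exists (e * (X * delta + h0) + (r + e * X * delta + e * r.+1 * (h0 + Cs) + e))%N.
move=> c cpos; have [cX|Xc] := leqP c X.
  exists (c * delta + h0)%N; split; last exact: hlin.
  apply: leq_trans (leq_addl _ _); apply: leq_trans (leq_addr _ _).
  by rewrite leq_mul2l leq_add2r leq_mul2r cX !orbT.
have c0X : (c0 %% X < X)%N by rewrite ltn_mod.
(* The largest index up to [c] in the class of [c0]. Fewer than [X] recurrence steps remain from
   there, at a cost absorbed by [beta]. *)
pose c' := ((c - c0 %% X) %/ X * X + c0 %% X)%N.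
have cc' : (c' <= c)%N.
  by have := leq_trunc_div (c - c0 %% X) X; rewrite /c'; lia.
have c'c : (c - c' < X)%N.
  have := divn_eq (c - c0 %% X) X; have := ltn_pmod (c - c0 %% X) X0.
  by rewrite /c'; lia.
have c'0 : (0 < c')%N by lia.
have c'mod : c' = c0 %[mod X] by rewrite /c' modnMDl modn_mod.
pose b0 := ((c + r) %/ k.+1)%N; pose H := (b0 * delta + h0 + Cs)%N.
have hH (i : 'I_r) : height_le H (c' + i).
  have [b [cb copb]] := hX c' i (ltn_ord i) c'mod; rewrite cb.
  have bpos : (0 < b)%N by move: cb; case: b copb => // _; rewrite muln0; lia.
  have bb0 : (b <= b0)%N.
    rewrite leq_divRL //; apply: leq_trans (_ : b * x i <= _)%N.
      by rewrite leq_mul2l xk orbT.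
    by rewrite mulnC -cb leq_add // ltnW.
  have [Q [Q0 sQ hQ]] := hlin b bpos.
  have hb : height_le (b * delta + h0) b.
    by exists Q; split=> //; have := hQ (Ordinal r0); rewrite addn0.
  apply: height_le_mono (hC i _ _ bpos copb hb).
  apply: leq_add; first by rewrite leq_add2r leq_mul2r bb0 orbT.
  by rewrite /Cs (bigD1 i) //= leq_addr.
have := window_le_add (c - c') (window_le_of_heights hH); rewrite subnKC // => hw.
exists ((c - c') * delta + (H + (H * r).+1))%N; split=> //.
have bk : (b0 * k <= c + r)%N.
  by apply: leq_trans (leq_trunc_div _ k.+1); rewrite leq_mul2l leqnSn orbT.
have -> : (e * ((c - c') * delta + (H + (H * r).+1)) =
   e * (c - c') * delta + (b0 * k + e * r.+1 * (h0 + Cs) + e))%N.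
  by rewrite /H /k; ring.
have le2 : (e * (c - c') * delta <= e * X * delta)%N.
  by rewrite leq_mul2r leq_mul2l (ltnW c'c) !orbT.
lia.
Qed.

(** * A common denominator and the recurrence with constant coefficients *)

Lemma rep_add Q Q' c N N' : rep Q c N -> rep Q' c N' ->
  rep (Q + Q') c (fun i => N i + N' i).
Proof.
move=> h h'; apply: near_zero_mono (near_zeroI h h') => n [e e'].
by rewrite combD -e -e' hornerD mulrDl.
Qed.

(** Numerators are left unbounded here; [size_coord_le] recovers their size. *)
Definition window_den Q c := forall i : 'I_r, exists N, rep Q (c + i) N.

Lemma window_den_next Q c : window_den Q c -> window_den (shiftp c (a r) * Q) c.+1.
Proof.
move=> hQ i; have [ir|ri] := ltnP i.+1 r.
  have [N hN] := hQ (Ordinal ir); exists (fun k => shiftp c (a r) * N k).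
  by rewrite addSnnS; apply: rep_mul.
have [N hN] := choice hQ.
have -> : (c.+1 + i = c + r)%N by have := ltn_ord i; lia.
by eexists; apply: rep_next.
Qed.

Lemma window_den_prev Q c : window_den Q c.+1 -> window_den (shiftp c (a 0) * Q) c.
Proof.
move=> hQ [[|i] ir]; last first.
  have [N hN] := hQ (Ordinal (ltnW ir)); exists (fun k => shiftp c (a 0) * N k).
  by rewrite /= -addSnnS; apply: rep_mul.
have [N hN] := choice hQ; eexists; rewrite /= addn0; apply: rep_prev => i.
by rewrite -addSnnS; apply: hN.
Qed.

Lemma window_den_forward Q c j : window_den Q c ->
  window_den (\prod_(c <= t < c + j) shiftp t (a r) * Q) (c + j).
Proof.
elim: j => [|j IHj] hQ; first by rewrite addn0 big_geq // mul1r.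
rewrite addnS big_nat_recr ?leq_addr //= [_ * shiftp _ _]mulrC -mulrA.
by apply/window_den_next/IHj.
Qed.

Lemma window_den_backward Q c j : window_den Q (c + j) ->
  window_den (\prod_(c <= t < c + j) shiftp t (a 0) * Q) c.
Proof.
elim: j c => [|j IHj] c hQ; first by rewrite addn0 big_geq // mul1r -[c]addn0.
rewrite big_ltn ?addnS ?ltnS ?leq_addr // -mulrA -addSn; apply: window_den_prev.
by apply: IHj; rewrite addSnnS.
Qed.

Hypothesis a_lo : a 0 != 0.

(* A pole of the coordinates of [f (n + c)] comes from a zero of some
   [a r (n + j)] with [j < c]; it disappears before index [M] only at a zero of
   some [a 0 (n + t)] with [t >= c], which forces [j >= c - s]. *)
Lemma common_denominator : (0 < r)%N -> exists s (Z D0 : {poly K}),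
  [/\ Z != 0, D0 != 0 & forall c M D, (s < c <= M)%N -> window_den D M ->
    exists N, rep (D * D0 * shiftp c Z) c N].
Proof.
move=> r0; have [s hs] := dispersion charK0 a_hi a_lo.
have [h0 [D0 [D00 _ hD]]] := window_le_1.
have {h0 hD}hD0 : window_den D0 1 by move=> i; have [N [_ hN]] := hD i; exists N.
(* After [shiftp c] these are the factors of the forward denominator at [n + c - 1], ...,
   [n + c - s], the only ones that dispersion does not separate from the backward denominator. *)
pose Z := \prod_(j < s) (a r \Po ('X - j.+1%:R%:P)).
exists s, Z, D0; split=> //.
  apply/prodf_neq0 => j _; rewrite -size_poly_eq0 size_comp_poly2 ?size_XsubC //.
  by rewrite size_poly_eq0.
move=> c M D /andP[sc cM] hD.
pose a1 := \prod_(1 <= t < c - s) shiftp t (a r).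
pose b := \prod_(c <= t < M) shiftp t (a 0).
have ZE : shiftp c Z = \prod_(c - s <= t < c) shiftp t (a r).
  rewrite -[X in \prod_(X <= _ < _) _]add0n big_addn (subKn (ltnW sc)) big_mkord.
  rewrite /shiftp rmorph_prod /=.
  rewrite [RHS](reindex_inj rev_ord_inj) /=; apply: eq_bigr => j _.
  rewrite -comp_polyA comp_polyB comp_polyX comp_polyC; congr (_ \Po _).
  rewrite -addrA -polyCB -natrB; last exact: leq_trans (ltn_ord j) (ltnW sc).
  by congr ('X + _%:R%:P); have := ltn_ord j; lia.
have cop : coprimep a1 b.
  rewrite /a1 /b !big_nat.
  apply: (big_ind (fun p => coprimep p _)) => [|p q hp hq|j /andP[_ jc]].
  - exact: coprime1p.
  - by rewrite coprimepMl hp.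
  apply: (big_ind (fun p => coprimep _ p)) => [|p q hp hq|t /andP[ct _]].
  - exact: coprimep1.
  - by rewrite coprimepMr hp.
  have jt : (j + s <= t)%N by lia.
  rewrite -(subnKC (leq_trans (leq_addr s j) jt)) -shiftpD.
  by apply: coprimep_comp_poly; apply: hs; lia.
have := window_den_forward (c.-1) hD0; rewrite add1n prednK ?(leq_ltn_trans _ sc) //.
rewrite (@big_cat_nat _ _ _ (c - s)) ?leq_subr ?subn_gt0 //= -/a1 -ZE.
move=> /(_ (Ordinal r0)); rewrite /= addn0 => -[N1 hN1].
have := @window_den_backward D c (M - c)%N; rewrite subnKC // -/b => /(_ hD).
move=> /(_ (Ordinal r0)); rewrite /= addn0 => -[N2 hN2].
(* Bezout combines the forward denominator [a1 * shiftp c Z * D0] and the backward one [b * D] into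
   [D * D0 * shiftp c Z], free of the long products [a1] and [b]. *)
have [[u v] /= uv] := Bezout_coprimepP _ _ cop.
have [e e0 euv] : exists2 e : K, e != 0 & u * a1 + v * b = e%:P.
  by move: uv; rewrite -size_poly_eq1 => /size_poly1P[e e0 ->]; exists e.
have := rep_add (rep_mul (e^-1 *: (u * D)) hN1)
  (rep_mul (e^-1 *: (v * D0 * shiftp c Z)) hN2).
set Q := (X in rep X); suff -> : Q = D * D0 * shiftp c Z by move=> h; eexists; apply: h.
transitivity (e^-1 *: (u * a1 + v * b) * (D * D0 * shiftp c Z)).
  by rewrite /Q -!mul_polyC; ring.
by rewrite euv -mul_polyC -polyCM mulVf // mul1r.
Qed.

(** Coordinates are unique, so numerators over a prescribed denominator inherit a bound from any
    representation of small height. *)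
Lemma size_coord_le Q Q' h c N N' : Q' != 0 -> rep Q c N -> rep Q' c N' ->
  (forall i, (size (N' i) <= h)%N) ->
  forall i, i \in B -> (size (N i) <= size Q + h)%N.
Proof.
move=> Q'0 hN hN' sN' i iB; have e := rep_unique hN hN' iB.
have [->|Ni0] := eqVneq (N i) 0; first by rewrite size_poly0.
apply: leq_trans (_ : size (Q' * N i)%R <= _)%N; last by rewrite e size_mul_le.
by rewrite size_mul // -subn1 -addnBAC ?size_poly_gt0 // leq_addl.
Qed.

(** The unknowns are [tau] constants; the equations are the coefficients, at most [H] each, of at
    most [r] numerators. *)
Lemma constant_recurrence L0 : (0 < r)%N -> (0 < L0)%N ->
  exists (Z : {poly K}) s0 tau (g : 'I_tau -> K),
  [/\ Z != 0, (exists t, g t != 0) &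
    near_zero (fun n => \sum_(t < tau)
      g t * (shiftp (1 + L0 * (s0 + t)) Z).[n%:R] * f (n + (1 + L0 * (s0 + t)))%N = 0)].
Proof.
(* Since [M] is about [L0 * tau], [e] makes [H0] about [tau / (4 * r)]. The [r * H] equations then
   number about [tau / 2] plus constants, and [tau] is chosen to absorb these. *)
move=> r0 L00; have [s [Z [D0 [Z0 D00 hden]]]] := common_denominator r0.
pose e := (4 * r * L0)%N.
have e0 : (0 < e)%N by rewrite !muln_gt0 r0 L00.
have [beta hb] := window_le_sublinear e r0.
pose kap := (size D0 + size Z)%N.
pose tau := (s + 2 + beta + 2 * r * kap + 1)%N.
pose c t := (1 + L0 * (s.+1 + t))%N; pose M := c tau.
have [//|hM [ehM [D [DD0 sD hD]]]] := hb M.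
have {}hD : window_den D M by move=> i; have [N [_ hN]] := hD i; exists N.
pose H0 := ((M + beta) %/ e)%N; pose H := (H0 + kap + H0)%N.
have cM t : (t <= tau)%N -> (c t <= M)%N.
  by move=> tt; rewrite /M /c leq_add2l leq_mul2l leq_add2l tt orbT.
have sct t : (s < c t)%N.
  rewrite /c add1n ltnS; apply: leq_trans (leq_pmull _ L00).
  exact: leq_trans (leqnSn s) (leq_addr _ _).
have hN (t : 'I_tau) : exists N : 'I_r -> {poly K},
    (forall i, i \in B -> (size (N i) <= H)%N) /\ rep (D * D0 * shiftp (c t) Z) (c t) N.
  have ct : (c t <= M)%N by apply: cM; apply: ltnW.
  have [|N hN] := hden (c t) M D _ hD; first by rewrite sct.
  have [//|h [eh [Q [Q0 _ hQ]]]] := hb (c t).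
  have [N' [sN' hN']] := hQ (Ordinal r0); rewrite /= addn0 in hN'.
  exists N; split=> // i iB.
  apply: leq_trans (size_coord_le Q0 hN hN' sN' iB) _; apply: leq_add; last first.
    by rewrite /H0 leq_divRL // mulnC; apply: leq_trans eh _; rewrite leq_add2r.
  rewrite -mulrA size_mul_le //.
    by apply: leq_trans sD _; rewrite /H0 leq_divRL // mulnC.
  by rewrite size_mul_le // size_shiftp.
have [N {}hN] := choice hN.
have card : (#|{: 'I_r * 'I_H}| < #|'I_tau|)%N.
  rewrite card_prod !card_ord.
  have eH : (e * H0 <= M + beta)%N by rewrite mulnC leq_trunc_div.
  have e1 : (L0 * (4 * r * H0) <= L0 * (s + tau + 2 + beta))%N.
    have -> : (L0 * (4 * r * H0) = e * H0)%N by rewrite /e; ring.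
    apply: leq_trans eH _; rewrite /M /c.
    have := leq_pmull beta L00; have := leq_pmull 1 L00.
    by rewrite !mulnDr mulnS; lia.
  rewrite leq_pmul2l // in e1.
  have -> : (r * H = 2 * (r * H0) + r * kap)%N by rewrite /H; ring.
  have e2 : (4 * r * H0 = 4 * (r * H0))%N by ring.
  have tE : (tau = s + 2 + beta + 2 * (r * kap) + 1)%N by rewrite /tau; ring.
  rewrite e2 in e1; clear -e1 tE; lia.
have [g [g0 hg]] := @lin_dep K 'I_tau ('I_r * 'I_H)%type
  (fun t ik => (N t ik.1)`_ik.2) card.
exists Z, s.+1, tau, g; split=> //.
have N0 i : i \in B -> \sum_t g t *: N t i = 0.
  move=> iB; apply/polyP => k; rewrite coef0 coef_sum.
  have [kH|Hk] := ltnP k H.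
    by rewrite -[RHS](hg (i, Ordinal kH)); apply: eq_bigr => t _; rewrite coefZ.
  rewrite big1 // => t _; rewrite coefZ nth_default ?mulr0 //.
  by apply: leq_trans Hk; apply: (hN t).1.
(* The factor [D * D0] is the same for all [t] and cancels; only [shiftp (c t) Z] stays attached to
   [f]. *)
have DD00 : D * D0 != 0 by rewrite mulf_neq0.
have := near_zeroI (poly_near_zero_neq0 charK0 DD00)
  (near_zero_forall (fun t => (hN t).2)).
apply: near_zero_mono => n [nz hn]; apply: (mulfI nz); rewrite mulr0 mulr_sumr.
transitivity (comb (fun i => \sum_t g t *: N t i) n).
  rewrite (comb_sum _ (fun t i => g t *: N t i)); apply: eq_bigr => t _.
  transitivity (comb (fun i => (g t)%:P * N t i) n).
    by rewrite combM hornerC -hn -/(c t) [(_ * shiftp _ _).[_]]hornerM; ring.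
  by rewrite /comb; apply: eq_bigr => i _; rewrite mul_polyC.
by rewrite /comb big1 // => i iB; rewrite N0 // hornerE mul0r.
Qed.

End Recurrence.
End Germs.

Lemma germ_structure (K : fieldType) (charK0 : [pchar K] =i pred0) (f : nat -> K)
    (r : nat) (a : nat -> {poly K}) (n1 : nat) :
  (forall n, (n1 <= n)%N -> \sum_(i < r.+1) (a i).[n%:R] * f (n + i)%N = 0) ->
  a 0 != 0 -> a r != 0 ->
  (forall m n : nat, (0 < m)%N -> (0 < n)%N -> coprime m n -> f (m * n)%N = f m * f n) ->
  exists L0 n0, [/\ (0 < L0)%N,
    forall (I : finType) (c : I -> nat) (l : I -> {poly K}),
      (forall i, (0 < c i)%N) ->
      near_zero (fun n => \sum_i (l i).[n%:R] * f (n + c i)%N = 0) ->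
      forall n, (n0 <= n)%N -> (L0 %| n)%N ->
        \sum_i (l i).[n%:R] * f (n + c i)%N = 0
  & exists (Z : {poly K}) tau (g : 'I_tau -> K) m0,
    [/\ Z != 0, (exists t, g t != 0) & forall m, (m0 <= m)%N ->
      \sum_(t < tau) g t * (Z.[(1 + L0 * (m + t))%:R] * f (1 + L0 * (m + t))%N) = 0]].
Proof.
move=> f_rec a_lo a_hi f_mult; have [B [B_free B_span]] := germ_basis_exists f r.
have [L0 [n0 [L00 unif]]] := uniform_relation charK0 f_rec a_hi B_free B_span.
(* If [r = 0] the recurrence makes [f] eventually zero, and a one-term relation suffices. *)
exists L0, n0; split=> //; have [r0|r0] := posnP r.
  have [m1 hm1] := poly_nat_neq0 charK0 a_hi.
  exists 1, 1%N, (fun=> 1), (maxn n1 m1); split; first exact: oner_neq0.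
    by exists ord0; apply: oner_neq0.
  move=> m; rewrite geq_max => /andP[n1m m1m].
  have le : (m <= 1 + L0 * m)%N by rewrite ltnW // add1n ltnS leq_pmull.
  have := f_rec _ (leq_trans n1m le); have := hm1 _ (leq_trans m1m le).
  rewrite big_ord1 r0 big_ord1 /= !addn0 => /negPf nz /eqP.
  by rewrite mulf_eq0 nz /= => /eqP ->; rewrite !mulr0.
have [Z [s0 [tau [g [Z0 g0 hg]]]]] :=
  constant_recurrence charK0 f_rec a_hi B_free B_span f_mult a_lo r0 L00.
exists Z, tau, g, (n0 + s0)%N; split=> // m le.
(* Evaluating the germ relation at [n = L0 * (m - s0)] yields a recurrence valid for every large
   [m]. *)
have /= := unif _ (fun t : 'I_tau => 1 + L0 * (s0 + t))%N
  (fun t : 'I_tau => g t *: shiftp (1 + L0 * (s0 + t)) Z).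
move=> /(_ _ _ (L0 * (m - s0))%N) hu; rewrite -[RHS]hu //.
- apply: eq_bigr => t _; rewrite hornerZ horner_shiftp.
  have -> : (L0 * (m - s0) + (1 + L0 * (s0 + t)) = 1 + L0 * (m + t))%N.
    have ms : (s0 <= m)%N by lia.
    by rewrite -{2}(subnK ms); ring.
  by rewrite mulrA.
- by apply: near_zero_mono hg => n h; rewrite -[RHS]h; apply: eq_bigr => t _; rewrite hornerZ.
- by apply: leq_trans (leq_pmull _ L00); lia.
- exact: dvdn_mulr.
Qed.

(** * Exponential polynomials *)

Section ExpPoly.
Variables (K : fieldType) (charK0 : [pchar K] =i pred0).
Implicit Types (l : seq (K * {poly K})) (p q P : {poly K}).

Definition epoly l (m : nat) : K := \sum_(e <- l) e.1 ^+ m * e.2.[m%:R].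

(** If [y m = a ^ m * q(m)], then [y (m + 1) - b * y m] is [a ^ m] times the value of [twist a b q]
    at [m]. *)
Definition twist (a b : K) q : {poly K} := a *: shiftp 1 q - b *: q.

Lemma horner_twist a b q m : (twist a b q).[m%:R] = a * q.[m.+1%:R] - b * q.[m%:R].
Proof. by rewrite hornerD hornerN !hornerZ horner_shiftp addn1. Qed.

Lemma coef_shiftpXn k i : (shiftp 1 'X^k : {poly K})`_i = 'C(k, i)%:R.
Proof.
rewrite /shiftp comp_Xn_poly exprD1n coef_sum.
have [ik|ki] := ltnP i k.+1.
  rewrite (bigD1 (Ordinal ik)) //= coefMn coefXn eqxx big1 ?addr0 // => j ji.
  rewrite coefMn coefXn; case: eqP => [ij|]; last by rewrite mul0rn.
  by case/eqP: ji; apply: val_inj.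
rewrite bin_small // big1 // => j _; rewrite coefMn coefXn.
by case: eqP => [e|]; rewrite ?mul0rn //; have := ltn_ord j; rewrite -e ltnNge ki.
Qed.

(** The top coefficient is removed with the twist of a monomial. If [a = b] the twist lowers the
    degree by one, hence the exponent [d] instead of [d.-1], and its leading coefficient [a * d] is
    nonzero in characteristic 0. *)
Lemma twist_surj a b q : a != 0 -> exists q', twist a b q' = q.
Proof.
move=> a0; have [d] := ubnP (size q); elim: d q => // d IHd q; rewrite ltnS => sq.
have [d0|d0] := posnP d.
  exists 0; rewrite d0 leqn0 size_poly_eq0 in sq.
  by rewrite (eqP sq) /twist /shiftp comp_poly0 !scaler0 subr0.
pose k := if a == b then d else d.-1; pose w := twist a b 'X^k.
have wE i : w`_i = a * 'C(k, i)%:R - b * (i == k)%:R.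
  by rewrite coefB !coefZ coef_shiftpXn coefXn.
have w0 : w`_d.-1 != 0.
  rewrite wE /k; case: (eqVneq a b) => [_|ab]; last by rewrite binn eqxx !mulr1 subr_eq0.
  rewrite [_ == d](_ : _ = false) /= ?mulr0 ?subr0; last by apply/eqP; lia.
  rewrite mulf_neq0 // natr_eq0_char0 // -lt0n bin_gt0; lia.
have wbig i : (d <= i)%N -> w`_i = 0.
  move=> di; rewrite wE /k; case: (eqVneq a b) => [->|_].
    move: di; rewrite leq_eqVlt => /orP[/eqP<-|di]; first by rewrite binn eqxx subrr.
    by rewrite bin_small // gtn_eqF //= !mulr0 subrr.
  by rewrite bin_small ?gtn_eqF /= ?mulr0 ?subrr //; lia.
have [|q' e] := IHd (q - (q`_d.-1 / w`_d.-1) *: w).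
  rewrite -[X in (_ < X)%N](prednK d0) ltnS; apply/leq_sizeP => i di.
  rewrite coefB coefZ; move: di; rewrite leq_eqVlt => /orP[/eqP<-|di].
    by rewrite divfK // subrr.
  have di' : (d <= i)%N by lia.
  by rewrite (wbig i) // mulr0 subr0 nth_default // (leq_trans sq).
exists (q' + (q`_d.-1 / w`_d.-1) *: 'X^k).
rewrite -[RHS](subrK ((q`_d.-1 / w`_d.-1) *: w)) -e /w /twist /shiftp.
by rewrite comp_polyD comp_polyZ !scalerDr !scalerN !scalerA ![a * _]mulrC
  ![b * _]mulrC; ring.
Qed.

Lemma lead_coef_shiftp c q : lead_coef (shiftp c q) = lead_coef q.
Proof.
rewrite lead_coef_comp ?size_XaddC // lead_coefDl ?lead_coefX ?expr1n ?mulr1 //.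
by rewrite size_polyX size_polyC; case: eqP.
Qed.

Lemma twist_eq0 a b q : a != b -> twist a b q = 0 -> q = 0.
Proof.
move=> ab /eqP; rewrite subr_eq0 => /eqP/(congr1 lead_coef).
rewrite !lead_coefZ lead_coef_shiftp => /eqP.
by rewrite -subr_eq0 -mulrBl mulf_eq0 subr_eq0 (negPf ab) /= lead_coef_eq0 => /eqP.
Qed.

Lemma size_twist a q : q != 0 -> (size (twist a a q) < size q)%N.
Proof.
move=> q0; rewrite -(prednK (_ : (0 < size q)%N)) ?size_poly_gt0 // ltnS.
apply/leq_sizeP => i; rewrite leq_eqVlt coefB !coefZ => /orP[/eqP<-|qi].
  by rewrite -{1}(size_shiftp 1 q) -!lead_coefE lead_coef_shiftp subrr.
have sq : (size q <= i)%N by case: (size q) qi.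
by rewrite !nth_default ?size_shiftp // !mulr0 subrr.
Qed.

(** Subtracting [y] times the sum from its shift twists all coefficients: that of [y] shrinks, and
    the others vanish only if they already did. Iteration eliminates the base [y]. *)
Lemma epoly_free_uniq (s : seq K) (C : K -> {poly K}) m0 :
  uniq s -> 0 \notin s ->
  (forall m, (m0 <= m)%N -> \sum_(x <- s) x ^+ m * (C x).[m%:R] = 0) ->
  forall x, x \in s -> C x = 0.
Proof.
elim: s C => // y s IHs C /= /andP[ys us]; rewrite inE negb_or eq_sym => /andP[y0 s0].
have [k] := ubnP (size (C y)); elim: k C => // k IHk C; rewrite ltnS => sC hC.
suff hs x : x \in s -> C x = 0.
  move=> x; rewrite inE => /orP[/eqP->|/hs//]; apply: poly_near_zero_eq0 => //.
  exists 1%N, m0; split=> // m le _; have := hC m le.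
  rewrite big_cons big_seq big1 ?addr0 => [/eqP|x' /hs ->]; last by rewrite hornerE mulr0.
  by rewrite mulf_eq0 expf_eq0 (negPf y0) andbF => /eqP.
have [Cy0|Cy0] := eqVneq (C y) 0.
  move=> xs; apply: (IHs C us s0 _ x xs) => m le; have := hC m le.
  by rewrite big_cons Cy0 hornerE mulr0 add0r.
move=> xs; apply: (@twist_eq0 x y).
  by apply: contraNneq ys => <-.
apply: (IHk (fun z => twist z y (C z))).
- by apply: leq_trans sC; apply: size_twist.
- move=> m le; have := hC m.+1 (leqW le); have := hC m le.
  move=> e1 e2; transitivity (\sum_(z <- y :: s) z ^+ m.+1 * (C z).[m.+1%:R]
     - y * \sum_(z <- y :: s) z ^+ m * (C z).[m%:R]); last by rewrite e1 e2 mulr0 subr0.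
  rewrite mulr_sumr -sumrB; apply: eq_bigr => z _.
  by rewrite horner_twist exprS; ring.
- by rewrite inE xs orbT.
Qed.

Definition ecoef l (x : K) : {poly K} := \sum_(e <- l | e.1 == x) e.2.

Lemma epoly_group l m :
  epoly l m = \sum_(x <- undup (map fst l)) x ^+ m * (ecoef l x).[m%:R].
Proof.
rewrite /epoly; symmetry.
transitivity (\sum_(x <- undup (map fst l)) \sum_(e <- l | e.1 == x) e.1 ^+ m * e.2.[m%:R]).
  apply: eq_bigr => x _; rewrite /ecoef horner_sum mulr_sumr.
  by apply: eq_bigr => e /eqP ->.
rewrite (exchange_big_dep predT) //= big_seq [RHS]big_seq; apply: eq_bigr => e el.
rewrite big_mkcond (bigD1_seq e.1) ?undup_uniq ?mem_undup ?map_f //= eqxx.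
by rewrite big1 ?addr0 // => x; rewrite eq_sym => /negPf ->.
Qed.

Lemma ecoef_out l x : x \notin map fst l -> ecoef l x = 0.
Proof.
move=> xl; rewrite /ecoef big_seq_cond big1 // => e /andP[el /eqP ex].
by case/negP: xl; rewrite -ex map_f.
Qed.

Lemma epoly_free l m0 : all (fun e => e.1 != 0) l ->
  (forall m, (m0 <= m)%N -> epoly l m = 0) -> forall x, ecoef l x = 0.
Proof.
move=> l0 hl x; have [xl|/ecoef_out//] := boolP (x \in map fst l).
apply: (@epoly_free_uniq (undup (map fst l)) (ecoef l) m0) => //.
- exact: undup_uniq.
- rewrite mem_undup; apply/mapP => -[e /(allP l0) e0 e1].
  by rewrite -e1 eqxx in e0.
- by move=> m /hl; rewrite epoly_group.
- by rewrite mem_undup.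
Qed.

Definition rec_op (P : {poly K}) (y : nat -> K) (m : nat) : K :=
  \sum_(i < size P) P`_i * y (m + i)%N.

Lemma rec_op_widen N P y m : (size P <= N)%N ->
  rec_op P y m = \sum_(i < N) P`_i * y (m + i)%N.
Proof.
move=> sP; rewrite /rec_op [RHS](bigID (fun i : 'I_N => (i < size P)%N)) /=.
rewrite [X in _ = _ + X]big1 ?addr0; last first.
  by move=> i; rewrite -leqNgt => /(nth_default _) ->; rewrite mul0r.
by rewrite (big_ord_widen_cond N predT (fun i => P`_i * y (m + i)%N)).
Qed.

Lemma rec_opMXsubC x P y m :
  rec_op (('X - x%:P) * P) y m = rec_op P (fun m => y m.+1 - x * y m) m.
Proof.
rewrite (@rec_op_widen (size P).+1); last first.
  by apply: leq_trans (size_polyMleq _ _) _; rewrite size_XsubC.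
under eq_bigr do rewrite mulrBl coefB mul_polyC coefZ coefXM mulrBl.
rewrite sumrB /= big_ord_recl /= mul0r add0r [X in _ - X]big_ord_recr /=.
rewrite nth_default // mulr0 mul0r addr0 -sumrB; apply: eq_bigr => i _.
by rewrite /bump /= addnS; ring.
Qed.

Lemma epoly_cat l l' m : epoly (l ++ l') m = epoly l m + epoly l' m.
Proof. exact: big_cat. Qed.

Lemma epoly_of_rec (s : seq K) y m0 :
  (forall m, (m0 <= m)%N -> rec_op (\prod_(x <- s) ('X - x%:P)) y m = 0) ->
  exists l m1, all (fun e => e.1 != 0) l /\ forall m, (m1 <= m)%N -> y m = epoly l m.
Proof.
elim: s y m0 => [|x s IHs] y m0 hy.
  exists [::], m0; split=> // m /hy.
  by rewrite /rec_op big_nil size_poly1 big_ord1 coef1 mul1r addn0 /epoly big_nil.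
have [m le|l [m1 [l0 hl]]] := IHs (fun m => y m.+1 - x * y m) m0.
  by rewrite -rec_opMXsubC; have := hy m le; rewrite big_cons.
(* A root 0 only delays the sequence by one index, so no base 0 is introduced. *)
have [x0|x0] := eqVneq x 0.
  exists [seq (e.1, e.1^-1 *: (e.2 \Po ('X - 1))) | e <- l], m1.+1; split.
    by rewrite all_map.
  case=> // m le; have := hl m le; rewrite x0 mul0r subr0 => ->.
  rewrite /epoly big_map big_seq [RHS]big_seq; apply: eq_bigr => e /(allP l0) e0 /=.
  rewrite hornerZ horner_comp; have -> : ('X - 1).[m.+1%:R] = m%:R :> K.
    by rewrite !hornerE -natr1 addrK.
  by rewrite exprSr -mulrA mulVKf.
(* Inverting the twist gives a particular solution; the multiple of [x ^+ m] still missing is fixed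
   by the value at [m1]. *)
have /choice[w hw] : forall e : K * {poly K}, exists q', e.1 != 0 -> twist e.1 x q' = e.2.
  move=> e; have [e0|e0] := eqVneq e.1 0; first by exists 0.
  by have [q' hq'] := twist_surj x e.2 e0; exists q'.
pose l' := [seq (e.1, w e) | e <- l].
have hl' m : epoly l' m.+1 - x * epoly l' m = epoly l m.
  rewrite /epoly !big_map mulr_sumr -sumrB big_seq [RHS]big_seq.
  apply: eq_bigr => e /(allP l0) e0 /=.
  by rewrite -[in RHS](hw e e0) horner_twist exprS; ring.
pose c := (y m1 - epoly l' m1) / x ^+ m1.
exists ((x, c%:P) :: l'), m1; split=> [|m le].
  by rewrite /= x0 all_map.
rewrite /epoly big_cons -/(epoly l' m) /= hornerC.
rewrite -(subnKC le); elim: (m - m1)%N => [|k IHk].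
  by rewrite addn0 mulrC divfK ?expf_neq0 // subrK.
have := hl (m1 + k)%N (leq_addr _ _); rewrite -hl' => /eqP.
rewrite subr_eq => /eqP; rewrite addnS => ->; rewrite IHk exprS; ring.
Qed.

Definition torsion (x : K) := exists2 k, (0 < k)%N & x ^+ k = 1.

Lemma torsion_exponent (s : seq K) :
  exists2 T, (0 < T)%N & forall x, x \in s -> torsion x -> x ^+ T = 1.
Proof.
elim: s => [|y s [T T0 hT]]; first by exists 1%N.
have [[k k0 yk]|nt] := pselect (torsion y); last first.
  exists T => // x; rewrite inE => /orP[/eqP->//|]; exact: hT.
exists (k * T)%N; first by rewrite muln_gt0 k0.
move=> x; rewrite inE => /orP[/eqP-> _|xs tx]; first by rewrite exprM yk expr1n.
by rewrite mulnC exprM hT // expr1n.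
Qed.

Lemma torsion_expP (x : K) k : (0 < k)%N -> torsion (x ^+ k) -> torsion x.
Proof.
by move=> k0 [j j0 e]; exists (k * j)%N; rewrite ?muln_gt0 ?k0 // exprM.
Qed.

Lemma torsion_eq_exp (x : K) i j : x != 0 -> (i < j)%N -> x ^+ i = x ^+ j -> torsion x.
Proof.
move=> x0 ij e; exists (j - i)%N; first by rewrite subn_gt0.
by apply: (mulfI (expf_neq0 i x0)); rewrite mulr1 -exprD subnKC // ltnW.
Qed.

Definition affp (u v : nat) q := q \Po (v%:R *: 'X + u%:R%:P).

Lemma horner_affp u v q t : (affp u v q).[t%:R] = q.[(u + v * t)%:R].
Proof. by rewrite horner_comp !hornerE addrC natrD natrM. Qed.

Lemma affp_eq0 u v q : (0 < v)%N -> (affp u v q == 0) = (q == 0).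
Proof.
move=> v0; rewrite -!size_poly_eq0 size_comp_poly2 // size_polyDl size_scale ?size_polyX
  ?natr_eq0_char0 -?lt0n //.
by rewrite size_polyC; case: eqP.
Qed.

Definition esub (u v : nat) P l :=
  [seq (e.1 ^+ v, (e.1 ^+ u *: affp u v e.2) * P) | e <- l].

Lemma epoly_esub u v P l t :
  epoly (esub u v P l) t = epoly l (u + v * t) * P.[t%:R].
Proof.
rewrite /epoly big_map mulr_suml; apply: eq_bigr => e _ /=.
by rewrite hornerM hornerZ horner_affp exprD exprM; ring.
Qed.

Lemma esub_neq0 u v P l : all (fun e => e.1 != 0) l ->
  all (fun e => e.1 != 0) (esub u v P l).
Proof. by move=> l0; rewrite all_map; apply: sub_all l0 => e e0; apply: expf_neq0. Qed.

(** Distinct bases stay distinct under powers, so [esub] cannot merge or cancel their terms. *)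
Definition torsion_free_ratios l := forall x y, x \in map fst l -> y \in map fst l ->
  forall k, (0 < k)%N -> x ^+ k = y ^+ k -> x = y.

Lemma ecoef_esub u v P l x : (0 < v)%N -> torsion_free_ratios l ->
  x \in map fst l -> ecoef (esub u v P l) (x ^+ v) = (x ^+ u *: affp u v (ecoef l x)) * P.
Proof.
move=> v0 tf xl; rewrite /ecoef big_map /= /affp raddf_sum /= scaler_sumr mulr_suml.
rewrite big_seq_cond [RHS]big_seq_cond; apply: eq_big => [e|e /andP[el /eqP e1]].
  have [el|//] := boolP (e \in l); rewrite /=; apply/eqP/eqP => [|->//].
  by apply: tf => //; apply: map_f.
by rewrite (tf _ _ (map_f fst el) xl v v0 e1).
Qed.

(* The two sides have bases [x ^ (N ^ 2)] and [x ^ N], so each base in the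
   support is, up to torsion, the [N]-th power of another one. *)
Lemma torsion_of_dilation l xi N (A C : {poly K}) t0 :
  all (fun e => e.1 != 0) l -> torsion_free_ratios l -> (1 < N)%N ->
  A != 0 -> C != 0 ->
  (forall t, (t0 <= t)%N -> epoly l (xi + N ^ 2 * t) * C.[t%:R] = epoly l (N * t) * A.[t%:R]) ->
  forall x, ecoef l x != 0 -> torsion x.
Proof.
move=> l0 tf N1 A0 C0 hl; have N0 := ltnW N1.
have N20 : (0 < N ^ 2)%N by rewrite expn_gt0 N0.
have inl x : ecoef l x != 0 -> x \in map fst l.
  by apply: contraNT => /ecoef_out ->.
have nz x : x \in map fst l -> x != 0 by move=> /mapP[e /(allP l0) e0 ->].
have step x : ecoef l x != 0 -> exists y, ecoef l y != 0 /\ x ^+ N = y ^+ (N ^ 2).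
  move=> cx; have xl := inl x cx.
  have := @epoly_free (esub xi (N ^ 2) C l ++ esub 0 N (- A) l) t0.
  rewrite all_cat !esub_neq0 // => /(_ isT) free.
  have /free/(_ (x ^+ N)) : forall m, (t0 <= m)%N ->
      epoly (esub xi (N ^ 2) C l ++ esub 0 N (- A) l) m = 0.
    by move=> t le; rewrite epoly_cat !epoly_esub hl // hornerN mulrN subrr.
  rewrite /ecoef big_cat -!/(ecoef _ _) /=.
  rewrite ecoef_esub // expr0 scale1r mulrN => /eqP; rewrite subr_eq0 => /eqP e.
  have : ecoef (esub xi (N ^ 2) C l) (x ^+ N) != 0.
    by rewrite e mulf_neq0 // affp_eq0.
  move=> ne; have : x ^+ N \in map fst (esub xi (N ^ 2) C l).
    by apply: contraNT ne => /ecoef_out ->.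
  move=> /mapP[e' /mapP[e'' el ->] /= xN].
  exists e''.1; split=> //; apply: contraNneq ne => c0; rewrite xN.
  rewrite ecoef_esub //; last exact: map_f.
  by rewrite (c0 : ecoef l _ = 0) /affp comp_poly0 scaler0 mul0r.
have /choice[nxt hnxt] : forall x, exists y,
    ecoef l x != 0 -> ecoef l y != 0 /\ x ^+ N = y ^+ (N ^ 2).
  by move=> x; have [/step[y]|] := boolP (ecoef l x != 0); [exists y|exists 0].
move=> x cx; pose z i := iter i nxt x.
have cz i : ecoef l (z i) != 0 by elim: i => // i IHi; have [] := hnxt _ IHi.
(* There are finitely many bases, so [z i = z j] for some [i < j]. Then [z i] has equal powers
   [N ^ (j - i)] and [N ^ (2 * (j - i))], so it is torsion, and [chain] carries this back to [x]. *)
have chain i k : z i ^+ (N ^ k) = z (i + k)%N ^+ (N ^ (2 * k)).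
  elim: k => [|k IHk]; first by rewrite addn0.
  rewrite expnSr exprM IHk -exprM mulnC exprM addnS (hnxt _ (cz (i + k)%N)).2.
  by rewrite -exprM -expnD mulnS.
have : ~~ uniq (mkseq z (size l).+1).
  apply/negP => u; have : {subset mkseq z (size l).+1 <= map fst l}.
    by move=> y; rewrite /mkseq => /mapP[i _ ->]; apply: inl.
  by move=> /(uniq_leq_size u); rewrite size_mkseq size_map ltnn.
move=> /(uniqPn 0)[i [j [ij]]]; rewrite size_mkseq => jl.
rewrite !nth_mkseq // ?(ltn_trans ij) // => zij.
have tz : torsion (z i).
  have := chain i (j - i)%N; rewrite subnKC ?(ltnW ij) // -zij.
  apply: torsion_eq_exp; first exact/nz/inl.
  by rewrite ltn_exp2l //; lia.
have := chain 0%N i; rewrite add0n => e.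
apply: (@torsion_expP _ (N ^ i)); rewrite ?expn_gt0 ?N0 //.
have [k k0 zk] := tz; exists k => //.
by rewrite [x ^+ _]e -exprM mulnC exprM zk expr1n.
Qed.

(** * From exponential polynomials to monomials, by multiplicativity *)

Section MultiplicativeExpPoly.
Variable f : nat -> K.
Hypothesis f_mult : forall m n : nat, (0 < m)%N -> (0 < n)%N -> coprime m n ->
  f (m * n)%N = f m * f n.

Lemma f_dilate N M t : (0 < N)%N -> f (N * (1 + M * N * t))%N = f N * f (1 + M * N * t)%N.
Proof.
move=> N0; apply: f_mult => //; rewrite mulnAC -coprime_modr addnC modnMDl.
by rewrite coprime_modr coprimen1.
Qed.

Lemma quasi_polynomial Z L0 l m0 : Z != 0 -> (0 < L0)%N -> all (fun e => e.1 != 0) l ->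
  (forall m, (m0 <= m)%N -> Z.[(1 + L0 * m)%:R] * f (1 + L0 * m)%N = epoly l m) ->
  near_zero (fun n => f (n + 1)%N = 0) \/
  exists M q m1, [/\ (0 < M)%N, q != 0 & forall m, (m1 <= m)%N ->
    Z.[(1 + M * m)%:R] * f (1 + M * m)%N = q.[m%:R]].
Proof.
move=> Z0 L00 l0 hl.
have [nr|nnr] := pselect (near_zero (fun n => f (n + 1)%N = 0)); first by left.
(* With step [L0 * T] every torsion base becomes 1, and distinct bases have no torsion ratio. *)
have [T T0 hT] := torsion_exponent (map fst l ++ [seq x / y | x <- map fst l, y <- map fst l]).
pose lT := esub 0 T 1 l; pose M := (L0 * T)%N.
have M0 : (0 < M)%N by rewrite muln_gt0 L00.
have lTE m : epoly lT m = epoly l (T * m) by rewrite epoly_esub !hornerE.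
have hlT m : (m0 <= m)%N -> Z.[(1 + M * m)%:R] * f (1 + M * m)%N = epoly lT m.
  move=> le; rewrite lTE -hl ?mulnA //; apply: leq_trans le _; exact: leq_pmull.
have lT0 : all (fun e => e.1 != 0) lT by apply: esub_neq0.
have baseT x : x \in map fst lT -> exists2 y, y \in map fst l & x = y ^+ T.
  by move=> /mapP[e /mapP[e' el ->] ->]; exists e'.1 => //; apply: map_f.
have nz x : x \in map fst l -> x != 0 by move=> /mapP[e /(allP l0) e0 ->].
have tf : torsion_free_ratios lT.
  move=> _ _ /baseT[x xl ->] /baseT[y yl ->] k k0 e.
  have y0 := nz y yl; have yT0 := expf_neq0 T y0.
  have : (x / y) ^+ T = 1.
    apply: hT; first by rewrite mem_cat; apply/orP; right; apply: allpairs_f.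
    exists (T * k)%N; first by rewrite muln_gt0 T0.
    by rewrite exprM expr_div_n expr_div_n e divff // expf_neq0.
  by rewrite expr_div_n => /(congr1 (fun z => z * y ^+ T)); rewrite divfK // mul1r.
have [n [n0 Mn fn]] : exists n, [/\ (0 < n)%N, (M %| n)%N & f (n + 1)%N != 0].
  apply: contrapT => nex; apply: nnr; exists M, 1%N; split=> // n n0 Mn.
  by apply/eqP; apply: contrapT => /negP fn; apply: nex; exists n.
case/dvdnP: Mn => xi nE; set N := (n + 1)%N in fn.
have N1 : (1 < N)%N by rewrite /N addn1 ltnS.
have N0 := ltnW N1.
(* For [y = 1 + M * N * t], the points [y] and [N * y] have indices [N * t] and [xi + N ^ 2 * t] in
   the progression. The two polynomials account for [Z] in [f (N * y) = f N * f y]. *)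
have tors : forall x, ecoef lT x != 0 -> torsion x.
  apply: (@torsion_of_dilation lT xi N (f N *: affp (1 + M * xi) (M * N ^ 2) Z)
    (affp 1 (M * N) Z) m0) => //.
  - by rewrite scaler_eq0 negb_or fn affp_eq0 // muln_gt0 M0 expn_gt0 N0.
  - by rewrite affp_eq0 // muln_gt0 M0.
  move=> t le; have le2 : (t <= N ^ 2 * t)%N by rewrite leq_pmull // expn_gt0 N0.
  rewrite -hlT; last by apply: leq_trans le (leq_trans le2 (leq_addl _ _)).
  rewrite -hlT; last by apply: leq_trans le _; apply: leq_pmull.
  rewrite hornerZ !horner_affp.
  have -> : (1 + M * (xi + N ^ 2 * t) = N * (1 + M * N * t))%N by rewrite /N nE; ring.
  have -> : (1 + M * xi + M * N ^ 2 * t = N * (1 + M * N * t))%N by rewrite /N nE; ring.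
  by rewrite f_dilate // mulnA; ring.
have c1 x : ecoef lT x != 0 -> x = 1.
  move=> cx; have : x \in map fst lT by apply: contraNT cx => /ecoef_out ->.
  move=> /baseT[y yl xE]; rewrite xE; apply: hT; first by rewrite mem_cat yl.
  by apply: (torsion_expP T0); rewrite -xE; apply: tors.
pose q := ecoef lT 1.
have qE m : epoly lT m = q.[m%:R].
  rewrite epoly_group; have [i1|o1] := boolP (1 \in undup (map fst lT)).
    rewrite (bigD1_seq 1) ?undup_uniq //= expr1n mul1r big1 ?addr0 // => x x1.
    have [->|/c1 e] := eqVneq (ecoef lT x) 0; first by rewrite hornerE mulr0.
    by rewrite e eqxx in x1.
  rewrite mem_undup in o1; rewrite /q (ecoef_out o1) hornerE big_seq big1 // => x.
  rewrite mem_undup => xl; have [->|/c1 e] := eqVneq (ecoef lT x) 0.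
    by rewrite hornerE mulr0.
  by rewrite -e xl in o1.
right; exists M, q, m0; split=> //; last by move=> m /hlT ->.
apply/eqP => q0; apply: nnr; have [z0 hz] := poly_nat_neq0 charK0 Z0.
exists M, (maxn (M * m0) z0)%N; split=> // k; rewrite geq_max => /andP[mk zk].
case/dvdnP=> i kE; rewrite kE mulnC leq_pmul2r // in mk.
have := hlT i mk; rewrite qE q0 hornerE => /eqP; rewrite mulf_eq0.
rewrite (negPf (hz _ _)) /=; last first.
  by apply: leq_trans zk _; rewrite kE mulnC leq_addl.
by rewrite kE mulnC addnC => /eqP.
Qed.

End MultiplicativeExpPoly.

Lemma coef_comp_scaleX (b : K) p i : (p \Po (b *: 'X))`_i = b ^+ i * p`_i.
Proof.
rewrite comp_polyE coef_sum; have [ip|pi] := ltnP i (size p).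
  rewrite (bigD1 (Ordinal ip)) //= big1 => [|k ki]; last first.
    rewrite coefZ exprZn coefZ coefXn; case: eqP => [e|]; last by rewrite !mulr0.
    by case/eqP: ki; apply: val_inj.
  by rewrite addr0 coefZ exprZn coefZ coefXn eqxx mulr1 mulrC.
rewrite nth_default // mulr0 big1 // => k _; rewrite coefZ exprZn coefZ coefXn.
by rewrite gtn_eqF ?mulr0 //; apply: leq_trans pi.
Qed.

(** Divisibility between equal sizes makes [p] an eigenvector of the homothety; the eigenvalues
    [N ^ i] are distinct in characteristic 0. *)
Lemma monomial_of_homothety p N : p != 0 -> (1 < N)%N ->
  (p \Po (N%:R *: 'X)) %| p -> exists c k, c != 0 /\ p = c *: 'X^k.
Proof.
move=> p0 N1 dv; have N0 := ltnW N1.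
have NK0 : N%:R != 0 :> K by rewrite natr_eq0_char0 // -lt0n.
have sp : size (p \Po (N%:R *: 'X)) = size p.
  by rewrite size_comp_poly2 // size_scale // size_polyX.
have /eqpfP e : p \Po (N%:R *: 'X) %= p by rewrite -dvdp_size_eqp // sp.
set g := (_ / _) in e.
have ci i : N%:R ^+ i * p`_i = g * p`_i.
  by rewrite -coef_comp_scaleX {1}e coefZ.
have lc0 : p`_(size p).-1 != 0 by rewrite -lead_coefE lead_coef_eq0.
have gE := mulIf lc0 (ci _).
exists p`_(size p).-1, (size p).-1; split=> //; apply/polyP => i.
rewrite coefZ coefXn; case: eqP => [->|ik]; first by rewrite mulr1.
rewrite mulr0; apply/eqP; apply: contrapT => /negP pi; apply: ik.
have := mulIf pi (ci i); rewrite -gE -!natrX => /(natr_inj_char0 charK0)/eqP.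
by rewrite eqn_exp2l // => /eqP.
Qed.

(** The hypothesis says that [A / C] is multiplied by [b] under the homothety. In lowest terms,
    Gauss's lemma makes numerator and denominator separately invariant up to scalars, hence
    monomials. *)
Lemma monomial_ratio (A C : {poly K}) (b : K) N : A != 0 -> C != 0 -> b != 0 -> (1 < N)%N ->
  (A \Po (N%:R *: 'X)) * C = b *: (C \Po (N%:R *: 'X)) * A ->
  exists c j k, c != 0 /\ A * 'X^j = c *: (C * 'X^k).
Proof.
move=> A0 C0 b0 N1 e; pose G := gcdp A C.
have G0 : G != 0 by rewrite gcdp_eq0 negb_and A0.
have AE : A = (A %/ G) * G by rewrite divpK // dvdp_gcdl.
have CE : C = (C %/ G) * G by rewrite divpK // dvdp_gcdr.
set A1 := A %/ G in AE; set C1 := C %/ G in CE.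
have A10 : A1 != 0 by apply: contraNneq A0 => h; rewrite AE h mul0r.
have C10 : C1 != 0 by apply: contraNneq C0 => h; rewrite CE h mul0r.
have cop : coprimep A1 C1 by rewrite coprimep_div_gcd // A0.
have NK0 : N%:R != 0 :> K by rewrite natr_eq0_char0 // -lt0n ltnW.
have s2 : size (N%:R *: 'X : {poly K}) = 2%N by rewrite size_scale // size_polyX.
have GN0 : G \Po (N%:R *: 'X) != 0 by rewrite -size_poly_eq0 size_comp_poly2 // size_poly_eq0.
have e1 : (A1 \Po (N%:R *: 'X)) * C1 = b *: (C1 \Po (N%:R *: 'X)) * A1.
  apply: (mulIf G0); apply: (mulIf GN0).
  move: e; rewrite {1 2}AE {1 2}CE !comp_polyM => e.
  rewrite -!scalerAl in e *.
  transitivity ((A1 \Po (N%:R *: 'X)) * (G \Po (N%:R *: 'X)) * (C1 * G)); first by ring.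
  by rewrite e; congr (_ *: _); ring.
have copN := coprimep_comp_poly (N%:R *: 'X) cop.
have [|c1 [k [c10 A1E]]] := monomial_of_homothety A10 N1.
  rewrite -(Gauss_dvdpr _ copN) -(dvdpZr _ _ b0) scalerAl -e1; exact: dvdp_mulIl.
have [|c2 [j [c20 C1E]]] := monomial_of_homothety C10 N1.
  rewrite coprimep_sym in copN; rewrite -(Gauss_dvdpr _ copN) e1 -scalerAl dvdpZr //.
  exact: dvdp_mulIl.
exists (c1 / c2), j, k; split; first by rewrite mulf_neq0 // invr_eq0.
rewrite AE CE A1E C1E -!scalerAl scalerA divfK //; congr (_ *: _); ring.
Qed.

Lemma monomial_germ (f : nat -> K) Z q M m1 :
  (forall m n : nat, (0 < m)%N -> (0 < n)%N -> coprime m n -> f (m * n)%N = f m * f n) ->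
  Z != 0 -> q != 0 -> (0 < M)%N ->
  (forall m, (m1 <= m)%N -> Z.[(1 + M * m)%:R] * f (1 + M * m)%N = q.[m%:R]) ->
  exists j k, near_zero (fun n => f (n + 1)%N * (n + 1)%:R ^+ j = (n + 1)%:R ^+ k).
Proof.
move=> f_mult Z0 q0 M0 hq.
have MK0 : M%:R != 0 :> K by rewrite natr_eq0_char0 // -lt0n.
pose A := q \Po (M%:R^-1 *: ('X - 1)).
have A0 : A != 0.
  rewrite -size_poly_eq0 size_comp_poly2 ?size_poly_eq0 //.
  by rewrite size_scale ?invr_eq0 // size_XsubC.
have hA m : (m1 <= m)%N -> Z.[(1 + M * m)%:R] * f (1 + M * m)%N = A.[(1 + M * m)%:R].
  move=> /hq ->; rewrite /A horner_comp; congr (_.[_]).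
  by rewrite !hornerE natrD addrC addKr natrM mulKf.
clearbody A; have [z0 hz] := poly_nat_neq0 charK0 (mulf_neq0 Z0 A0).
(* This places [N] past the zeros of [Z] and [A], so that [f N] is nonzero. *)
pose m2 := (m1 + z0).+1; pose N := (1 + M * m2)%N.
have m1m2 : (m1 <= m2)%N by rewrite ltnW // ltnS leq_addr.
have z0m2 : (z0 <= m2)%N by rewrite ltnW // ltnS leq_addl.
have m2N : (m2 < N)%N by rewrite /N add1n ltnS leq_pmull.
have N1 : (1 < N)%N by apply: leq_ltn_trans m2N.
have N0 := ltnW N1.
have := hz N; rewrite hornerM mulf_eq0 negb_or => /(_ _)/andP[|ZN AN].
  exact: leq_trans z0m2 (ltnW m2N).
have fN : f N != 0.
  by apply: contraNneq AN => fN; rewrite -hA -/N ?fN ?mulr0.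
have pe : (A \Po (N%:R *: 'X)) * Z = f N *: (Z \Po (N%:R *: 'X)) * A.
  apply/eqP; rewrite -subr_eq0 -(affp_eq0 1 _ (_ : 0 < M * N)%N) ?muln_gt0 ?M0 ?N0 //.
  apply/eqP; apply: poly_near_zero_eq0 => //; exists 1%N, m1; split=> // t le _.
  rewrite horner_affp hornerD hornerN !hornerM hornerZ !horner_comp !hornerZ hornerX -natrM.
  have e : (N * (1 + M * N * t) = 1 + M * (m2 + N ^ 2 * t))%N by rewrite /N; ring.
  rewrite e -hA; last exact: leq_trans m1m2 (leq_addr _ _).
  have hy : Z.[(1 + M * N * t)%:R] * f (1 + M * N * t)%N = A.[(1 + M * N * t)%:R].
    by rewrite -mulnA; apply: hA; apply: leq_trans le _; apply: leq_pmull.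
  by rewrite -e (f_dilate f_mult M t N0) -hy; ring.
have [c [j [k [c0 AZ]]]] := monomial_ratio A0 Z0 fN N1 pe.
have hf m : (m1 <= m)%N -> (z0 <= m)%N ->
    f (1 + M * m)%N * (1 + M * m)%:R ^+ j = c * (1 + M * m)%:R ^+ k.
  move=> m1m z0m; set y := (1 + M * m)%N.
  have my : (m <= y)%N by rewrite /y ltnW // add1n ltnS leq_pmull.
  have := hz y (leq_trans z0m my); rewrite hornerM mulf_eq0 negb_or => /andP[Zy _].
  apply: (mulfI Zy); have := congr1 (fun p => p.[y%:R]) AZ.
  by rewrite /= hornerZ !hornerM !hornerXn -hA // -/y => e; rewrite mulrA e; ring.
(* Comparing [f (N * y)] with [f N * f y] gives [c * c = c]. *)
have c1 : c = 1.
  have NK : N%:R != 0 :> K by rewrite natr_eq0_char0 // -lt0n.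
  set t := m2; have yE := @f_dilate f f_mult N M t N0; set y := (1 + M * N * t)%N in yE.
  have yK : y%:R != 0 :> K by rewrite natr_eq0_char0.
  have e1 : f N * N%:R ^+ j = c * N%:R ^+ k by apply: hf.
  have e2 : f y * y%:R ^+ j = c * y%:R ^+ k.
    have le : (m2 <= N * t)%N by apply: leq_pmull.
    by rewrite /y -mulnA; apply: hf; [apply: leq_trans m1m2 le|apply: leq_trans z0m2 le].
  have e3 : f (N * y)%N * (N * y)%:R ^+ j = c * (N * y)%:R ^+ k.
    have -> : (N * y = 1 + M * (m2 + N ^ 2 * t))%N by rewrite /y /N; ring.
    by apply: hf; [apply: leq_trans m1m2 _|apply: leq_trans z0m2 _]; apply: leq_addr.
  have : c * (c * (N * y)%:R ^+ k) = 1 * (c * (N * y)%:R ^+ k).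
    rewrite mul1r -[RHS]e3 yE natrM !exprMn.
    transitivity ((f N * N%:R ^+ j) * (f y * y%:R ^+ j)); last by ring.
    by rewrite e1 e2; ring.
  by apply: mulIf; rewrite mulf_neq0 // expf_neq0 // natrM mulf_neq0.
exists j, k; exists M, (M * (m1 + z0))%N; split=> // n le /dvdnP[i nE].
rewrite nE mulnC leq_pmul2r // in le.
by have := hf i; rewrite c1 mul1r nE mulnC addnC; apply; apply: leq_trans le;
  [apply: leq_addr|apply: leq_addl].
Qed.

End ExpPoly.

(** * Splitting the characteristic polynomial in an extension *)

Lemma poly_root_extension (K : fieldType) (p : {poly K}) : (1 < size p)%N ->
  exists (L : fieldType) (io : {rmorphism K -> L}) (z : L), root (map_poly io p) z.
Proof.
have [n] := ubnP (size p); elim: n p => // n IHn p; rewrite ltnS => sp p1.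
have p0 : p != 0 by rewrite -size_poly_gt0 ltnW.
have [irr|] := pselect (irreducible_poly p).
  have [L _ [z pz _]] := irredp_FAdjoin irr.
  by exists L, (in_alg L : {rmorphism K -> L}), z.
move=> nirr; have [q [q1 qp nqp]] : exists q : {poly K}, [/\ size q != 1%N, q %| p & ~~ (q %= p)].
  apply: contrapT => nex; apply: nirr; split=> // q q1 qp; apply: contrapT => /negP nqp.
  by apply: nex; exists q.
have q0 : q != 0 by apply: contraTneq qp => ->; rewrite dvd0p.
have sqp : (size q < size p)%N.
  rewrite ltn_neqAle dvdp_leq // andbT; apply: contra nqp => e.
  by rewrite -dvdp_size_eqp.
have q1' : (1 < size q)%N by rewrite ltn_neqAle eq_sym q1 size_poly_gt0.
have [L [io [z qz]]] := IHn q (leq_trans sqp sp) q1'.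
exists L, io, z; case/dvdpP: qp => h ->.
by rewrite rmorphM rootM qz orbT.
Qed.

Lemma poly_split_extension (K : fieldType) (p : {poly K}) : p != 0 ->
  exists (L : fieldType) (io : {rmorphism K -> L}) (s : seq L),
    map_poly io p = io (lead_coef p) *: \prod_(x <- s) ('X - x%:P).
Proof.
have [n] := ubnP (size p); elim: n K p => // n IHn K p; rewrite ltnS => sp p0.
have [p1|p1] := leqP (size p) 1.
  exists K, idfun, [::]; rewrite big_nil alg_polyC map_poly_id //.
  by rewrite (size1_polyC p1) lead_coefC.
have [L [io [z pz]]] := poly_root_extension p1.
have /factor_theorem[q qE] := pz.
have ip0 : map_poly io p != 0 by rewrite map_poly_eq0.
have q0 : q != 0 by apply: contraNneq ip0 => q0; rewrite qE q0 mul0r.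
have sq : size p = (size q).+1.
  by rewrite -(size_map_poly io) qE size_Mmonic ?monicXsubC // size_XsubC addn2.
have [|L' [io' [s hs]]] := IHn L q _ q0; first by rewrite sq in sp.
exists L', (io' \o io : {rmorphism K -> L'}), (io' z :: s).
rewrite map_poly_comp qE rmorphM /= hs rmorphB /= map_polyX map_polyC big_cons.
have -> : lead_coef q = io (lead_coef p).
  by rewrite -lead_coef_map qE lead_coef_Mmonic ?monicXsubC.
by rewrite -scalerAl [in RHS]mulrC.
Qed.

(** The characteristic roots live in an extension [L], but both alternatives are equations between
    elements of [K] and descend along the injective [io]. *)
Lemma germ_dichotomy (K : fieldType) (charK0 : [pchar K] =i pred0) (f : nat -> K)
    (Z : {poly K}) L0 tau (g : 'I_tau -> K) m0 :
  (forall m n : nat, (0 < m)%N -> (0 < n)%N -> coprime m n -> f (m * n)%N = f m * f n) ->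
  Z != 0 -> (0 < L0)%N -> (exists t, g t != 0) ->
  (forall m, (m0 <= m)%N ->
    \sum_(t < tau) g t * (Z.[(1 + L0 * (m + t))%:R] * f (1 + L0 * (m + t))%N) = 0) ->
  near_zero (fun n => f (n + 1)%N = 0) \/
  exists j k, near_zero (fun n => f (n + 1)%N * (n + 1)%:R ^+ j = (n + 1)%:R ^+ k).
Proof.
move=> f_mult Z0 L00 [t0 gt0] hrec.
pose G := \sum_(t < tau) g t *: 'X^t.
have Gc (t : 'I_tau) : G`_t = g t.
  rewrite coef_sum (bigD1 t) //= coefZ coefXn eqxx mulr1 big1 ?addr0 // => i it.
  by rewrite coefZ coefXn eq_sym val_eqE (negPf it) mulr0.
have sG : (size G <= tau)%N.
  apply: leq_trans (size_sum _ _ _) _; apply/bigmax_leqP => t _.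
  by apply: leq_trans (size_scale_leq _ _) _; rewrite size_polyXn.
have G0 : G != 0 by apply: contraNneq gt0 => G0; rewrite -Gc G0 coef0.
have [L [io [s hs]]] := poly_split_extension G0.
have charL0 : [pchar L] =i pred0 by move=> x; rewrite (fmorph_pchar io) charK0.
pose fL := io \o f.
have fL_mult m n : (0 < m)%N -> (0 < n)%N -> coprime m n -> fL (m * n)%N = fL m * fL n.
  by move=> *; rewrite /fL /= f_mult // rmorphM.
pose ZL := map_poly io Z; have ZL0 : ZL != 0 by rewrite map_poly_eq0.
pose y m := ZL.[(1 + L0 * m)%:R] * fL (1 + L0 * m)%N.
have [m le|l [m1 [l0 hl]]] := @epoly_of_rec L charL0 s y m0.
  have lc0 : io (lead_coef G) != 0 by rewrite fmorph_eq0 lead_coef_eq0.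
  apply: (mulfI lc0); rewrite mulr0 -(rmorph0 io) -(hrec m le).
  rewrite (@rec_op_widen _ tau); last first.
    by move: sG; rewrite -(size_map_poly io) hs size_scale.
  rewrite mulr_sumr rmorph_sum; apply: eq_bigr => t _.
  rewrite mulrA -coefZ -hs coef_map Gc rmorphM; congr (_ * _).
  by rewrite rmorphM /y /ZL /= -[in RHS]horner_map /= rmorph_nat.
have [h|[M [q [m2 [M0 q0 hq]]]]] := quasi_polynomial charL0 fL_mult ZL0 L00 l0 hl.
  left; apply: near_zero_mono h => n /eqP; rewrite /fL /= fmorph_eq0.
  by move/eqP.
right; have [j [k h]] := monomial_germ charL0 fL_mult ZL0 q0 M0 hq.
exists j, k; apply: near_zero_mono h => n; rewrite /fL /= => e.
by apply: (fmorph_inj io); rewrite rmorphM !rmorphXn /= rmorph_nat.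
Qed.

(** * Algebraic power series *)

Lemma clear_denominators (R : idomainType) (p : {poly {fraction R}}) :
  (forall x : {fraction R}, exists n d, d != 0 /\ x = FracField.tofrac n / FracField.tofrac d) ->
  exists (D : R) (A : {poly R}),
    D != 0 /\ map_poly (@FracField.tofrac R) A = FracField.tofrac D *: p.
Proof.
move=> fr; elim/poly_ind: p => [|p c [D [A [D0 hA]]]].
  by exists 1, 0; rewrite oner_neq0 rmorph0 scaler0.
have [n [d [d0 ->]]] := fr c; have fd0 : FracField.tofrac d != 0 by rewrite tofrac_eq0.
exists (D * d), ((d *: A) * 'X + (D * n)%:P); split; first by rewrite mulf_neq0.
rewrite rmorphD rmorphM /= map_polyZ map_polyX map_polyC /= hA.
rewrite scalerDr; congr (_ + _).
  by rewrite scalerA -scalerAl rmorphM /= [_ d * _]mulrC.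
rewrite scale_polyC; congr polyC; rewrite !rmorphM /= -[RHS]mulrA; congr (_ * _).
by rewrite mulrCA divff // mulr1.
Qed.

Section Theta.
Variables (K : fieldType) (charK0 : [pchar K] =i pred0).
Implicit Types (F G H : fps K) (A B C : {poly {poly K}}) (p q : {poly K}).
Local Notation "p %:fps" := (fps_of_poly p) (at level 1, format "p %:fps").

(** The Euler derivation [z d/dz]: its iterates multiply the coefficients by powers of [n]. *)
Definition theta F : fps K := Fps (fun n => n%:R * F n).

Definition thetap p : {poly K} := 'X * p^`().

Lemma thetap_is_zmod_morphism : zmod_morphism thetap.
Proof. by move=> p q; rewrite /thetap derivB mulrBr. Qed.

HB.instance Definition _ :=
  GRing.isZmodMorphism.Build {poly K} {poly K} thetap thetap_is_zmod_morphism.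

Lemma theta_is_zmod_morphism : zmod_morphism theta.
Proof. by move=> F G; apply: fpsP => n /=; rewrite mulrBr. Qed.

HB.instance Definition _ :=
  GRing.isZmodMorphism.Build (fps K) (fps K) theta theta_is_zmod_morphism.

Lemma thetaM F G : theta (F * G) = theta F * G + F * theta G.
Proof.
apply: fpsP => n /=; rewrite mulr_sumr -big_split /=; apply: eq_bigr => -[i /=].
rewrite ltnS => le _; rewrite -{1}(subnKC le) natrD; ring.
Qed.

Lemma theta_fps_of_poly p : theta p%:fps = (thetap p)%:fps.
Proof.
apply: fpsP => n /=; rewrite /thetap coefXM; case: n => [|n] /=; first by rewrite mul0r.
by rewrite coef_deriv mulr_natl.
Qed.

Lemma iter_thetaE i F n : iter i theta F n = n%:R ^+ i * F n.
Proof. by elim: i => [|i IHi] /=; rewrite ?mul1r // IHi exprS mulrA. Qed.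

Definition evalF F A : fps K := (map_poly (@fps_of_poly K) A).[F].

Lemma evalF_is_zmod_morphism F : zmod_morphism (evalF F).
Proof. by move=> A B; rewrite /evalF rmorphB hornerD hornerN. Qed.

Lemma evalF_is_monoid_morphism F : monoid_morphism (evalF F).
Proof.
by split=> [|A B]; rewrite /evalF ?rmorph1 ?hornerE // rmorphM hornerM.
Qed.

HB.instance Definition _ F := GRing.isZmodMorphism.Build {poly {poly K}} (fps K)
  (evalF F) (evalF_is_zmod_morphism F).
HB.instance Definition _ F := GRing.isMonoidMorphism.Build {poly {poly K}} (fps K)
  (evalF F) (evalF_is_monoid_morphism F).

Lemma evalFC F p : evalF F p%:P = p%:fps.
Proof. by rewrite /evalF map_polyC hornerC. Qed.

Lemma evalFX F : evalF F 'X = F.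
Proof. by rewrite /evalF map_polyX hornerX. Qed.

Lemma evalFZ F p A : evalF F (p *: A) = p%:fps * evalF F A.
Proof. by rewrite -mul_polyC rmorphM /= evalFC. Qed.

(** Chain rule; [map_poly thetap A] differentiates the coefficients of [A]. *)
Lemma theta_evalF F A :
  theta (evalF F A) = evalF F (map_poly thetap A) + evalF F A^`() * theta F.
Proof.
elim/poly_ind: A => [|A p IHA].
  by rewrite deriv0 !raddf0 mul0r addr0.
rewrite rmorphD raddfD /= rmorphM /= evalFC evalFX thetaM IHA theta_fps_of_poly.
rewrite derivD derivM derivX derivC addr0 mulr1 raddfD /= map_polyC /= !rmorphD /=.
have -> : map_poly thetap (A * 'X) = map_poly thetap A * 'X.
  apply/polyP => i; rewrite coef_map /= !coefMX coef_map /=.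
  by case: eqP => // _; rewrite raddf0.
by rewrite !rmorphM /= evalFX !evalFC; ring.
Qed.

Definition alg_rel F A := A != 0 /\ evalF F A = 0.

Lemma fps_algebraic_rel F : fps_algebraic F -> exists A, alg_rel F A.
Proof.
move=> [p p0 /eqP pF].
have [x|D [A [D0 hA]]] := @clear_denominators _ p.
  by exists \n_(repr x), \d_(repr x); rewrite denom_ratioP; split=> //; apply: ratfun_numden.
exists A; split.
  apply: contraNneq p0 => A0; move/eqP: hA; rewrite A0 rmorph0 eq_sym scaler_eq0.
  by rewrite tofrac_eq0 (negPf D0).
apply/eqP; rewrite -tofrac_eq0 /evalF -horner_map /= -map_poly_comp /=.
have e x : ratfun_to_laurent (FracField.tofrac x) = fps_to_laurent x%:fps :> laurent K.
  have := @ratfun_to_laurentE K x 1 (oner_neq0 _).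
  by rewrite rmorph1 divr1 /fps_to_laurent rmorph1 /= rmorph1 divr1.
set P := map_poly _ A; have -> : P = map_poly (@ratfun_to_laurent K) (map_poly (@FracField.tofrac _) A).
  by rewrite -map_poly_comp /P; apply: eq_map_poly => x; rewrite /= e.
rewrite hA map_polyZ hornerZ; apply/eqP; rewrite -[RHS](mulr0 (ratfun_to_laurent (FracField.tofrac D))).
by congr (_ * _).
Qed.

Definition min_rel F A := alg_rel F A /\
  forall B, evalF F B = 0 -> (size B < size A)%N -> B = 0.

Lemma min_rel_exists F : (exists A, alg_rel F A) -> exists A, min_rel F A.
Proof.
move=> exA; have exn : exists n, `[< exists A, alg_rel F A /\ size A = n >].
  by have [A hA] := exA; exists (size A); apply/asboolP; exists A.
case: (ex_minnP exn) => n /asboolP[A [hA sA]] minn; exists A; split=> // B hB sB.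
apply/eqP; apply: contrapT => /negP B0; move: sB; rewrite sA ltnNge => /negP; apply.
by apply: minn; apply/asboolP; exists B.
Qed.

Lemma min_rel_size F A : min_rel F A -> (1 < size A)%N.
Proof.
move=> [[A0 hA] _]; rewrite ltnNge; apply/negP => /size1_polyC AE.
move: hA; rewrite AE evalFC => e; case/eqP: A0; rewrite AE.
have -> : A`_0 = 0 by apply: (@fps_of_poly_inj K); rewrite e rmorph0.
by rewrite polyC0.
Qed.

(** Pseudo-division by [A] leaves remainders with [(size A).-1] coordinates over [K[z]]; the powers
    of [lead_coef A] pay for the division. *)
Lemma evalF_dependent F A (I : finType) (g : I -> {poly {poly K}}) :
  alg_rel F A -> ((size A).-1 < #|I|)%N ->
  exists c : I -> {poly K}, (exists i, c i != 0) /\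
    \sum_i (c i)%:fps * evalF F (g i) = 0.
Proof.
move=> [A0 hA] lt; set d := (size A).-1 in lt.
pose rm i := g i %% A.
have [c [[i0 ci0] hc]] := @lin_dep {poly K} I 'I_d (fun i j => (rm i)`_j)
  (eq_ind_r (fun n => n < #|I|)%N lt (card_ord d)).
pose k i := scalp (g i) A.
exists (fun i => c i * lead_coef A ^+ k i); split.
  by exists i0; rewrite mulf_neq0 // expf_neq0 // lead_coef_eq0.
transitivity (evalF F (\sum_i c i *: rm i)); last first.
  suff -> : \sum_i c i *: rm i = 0 by rewrite rmorph0.
  apply/polyP => j; rewrite coef0 coef_sum; have [jd|dj] := ltnP j d.
    by rewrite -[RHS](hc (Ordinal jd)); apply: eq_bigr => i _; rewrite coefZ.
  rewrite big1 // => i _; rewrite coefZ nth_default ?mulr0 //; apply: leq_trans dj.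
  by rewrite -ltnS /d prednK ?size_poly_gt0 // ltn_modp.
rewrite rmorph_sum; apply: eq_bigr => i _; rewrite /= evalFZ rmorphM /= -mulrA.
congr (_ * _); rewrite -evalFZ Pdiv.Idomain.divp_eq rmorphD rmorphM /= hA mulr0 add0r.
by [].
Qed.

Lemma theta_in_span F : (exists A, alg_rel F A) ->
  exists (W : {poly K}) B, W != 0 /\ W%:fps * theta F = evalF F B.
Proof.
move=> /min_rel_exists[A hA]; have sA := min_rel_size hA.
have [[A0 evA] minA] := hA; pose d := (size A).-1.
have dA : d.+1 = size A by rewrite /d prednK // ltnW.
have A'0 : evalF F A^`() != 0.
  apply/eqP => /minA; rewrite lt_size_deriv // => /(_ isT) e.
  have := congr1 (fun p : {poly {poly K}} => p`_d.-1) e; rewrite coef_deriv coef0.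
  rewrite prednK; last by rewrite -ltnS dA.
  move=> /eqP; rewrite -mulr_natr mulf_eq0 -lead_coefE lead_coef_eq0 (negPf A0) /=.
  by rewrite -polyC_natr polyC_eq0 natr_eq0_char0 // => /eqP d0; move: sA; rewrite -dA d0.
have [||c [[i0 ci0] hc]] := @evalF_dependent F A 'I_d.+1
  (fun i => if (i < d)%N then A^`() * 'X^i else 1); first by [].
  by rewrite card_ord.
pose c' (i : 'I_d) := c (widen_ord (leqnSn d) i); pose W := c ord_max.
pose V := \sum_(i < d) c' i *: 'X^i.
have Vc (i : 'I_d) : V`_i = c' i.
  rewrite coef_sum (bigD1 i) //= coefZ coefXn eqxx mulr1 big1 ?addr0 // => k ki.
  by rewrite coefZ coefXn eq_sym val_eqE (negPf ki) mulr0.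
have hV : W%:fps = - (evalF F V * evalF F A^`()).
  apply/eqP; rewrite -addr_eq0 -[X in _ == X]hc big_ord_recr /= ltnn rmorph1 mulr1.
  rewrite addrC /V rmorph_sum mulr_suml; apply/eqP; congr (_ + _); apply: eq_bigr => i _.
  by rewrite /= ltn_ord evalFZ rmorphM /=; ring.
have W0 : W != 0.
  apply/negP => /eqP W0; move: hV; rewrite W0 rmorph0 => /esym/eqP.
  rewrite oppr_eq0 mulf_eq0 (negPf A'0) orbF => /eqP/minA V0.
  have {}V0 : V = 0.
    apply: V0; rewrite -dA ltnS; apply: leq_trans (size_sum _ _ _) _.
    apply/bigmax_leqP => i _; apply: leq_trans (size_scale_leq _ _) _.
    by rewrite size_polyXn.
  case/eqP: ci0; have [id|di] := ltnP i0 d.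
    have := Vc (Ordinal id); rewrite V0 coef0 /c' => ->.
    by congr c; apply: val_inj.
  rewrite -W0; congr c; apply: val_inj; apply/eqP.
  by rewrite eqn_leq di -ltnS ltn_ord.
exists W, (V * map_poly thetap A); split=> //.
have := theta_evalF F A; rewrite evA raddf0 => /esym/eqP.
rewrite addr_eq0 => /eqP e; rewrite rmorphM /= e hV; ring.
Qed.

Lemma iter_theta_in_span F W B : W%:fps * theta F = evalF F B ->
  forall i, exists C, (W ^+ i)%:fps * iter i theta F = evalF F C.
Proof.
move=> hW; elim=> [|i [C hC]]; first by exists 'X; rewrite rmorph1 mul1r evalFX.
exists (W *: map_poly thetap C + C^`() * B - (i%:R * thetap W) *: C).
have hi : W%:fps * (thetap (W ^+ i))%:fps = (i%:R * thetap W)%:fps * (W ^+ i)%:fps.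
  rewrite -!rmorphM /=; congr fps_of_poly; rewrite /thetap deriv_exp.
  case: i {hC} => [|i]; first by rewrite mulr0n mulr0 !mul0r mulr0.
  by rewrite -[_ *+ _]mulr_natl exprS /=; ring.
rewrite rmorphB rmorphD /= !evalFZ rmorphM /= -hW -hC.
have := theta_evalF F C; rewrite -hC thetaM theta_fps_of_poly => e.
transitivity (W%:fps * ((thetap (W ^+ i))%:fps * iter i theta F
    + (W ^+ i)%:fps * theta (iter i theta F))
  - W%:fps * (thetap (W ^+ i))%:fps * iter i theta F).
  by rewrite exprS rmorphM /=; ring.
by rewrite e hi; ring.
Qed.

Lemma algebraic_iter_theta F i : (exists A, alg_rel F A) ->
  exists A, alg_rel (iter i theta F) A.
Proof.
move=> hF; have [A hA] := hF; have [W [B [W0 hW]]] := theta_in_span hF.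
have [C hC] := iter_theta_in_span hW i.
have [|c [[j0 cj0] hc]] := @evalF_dependent F A 'I_(size A) (fun j => C ^+ j) hA.
  by rewrite card_ord prednK // size_poly_gt0; case: hA.
pose P := \sum_(j < size A) (c j * (W ^+ i) ^+ j) *: 'X^j : {poly {poly K}}.
exists P; split.
  apply/negP => /eqP P0; move: cj0.
  have : P`_j0 = c j0 * (W ^+ i) ^+ j0.
    rewrite coef_sum (bigD1 j0) //= coefZ coefXn eqxx mulr1 big1 ?addr0 // => k kj.
    by rewrite coefZ coefXn eq_sym val_eqE (negPf kj) mulr0.
  rewrite P0 coef0 => /esym/eqP; rewrite mulf_eq0 => /orP[->//|].
  by rewrite !expf_eq0 (negPf W0) !andbF.
rewrite -hc rmorph_sum; apply: eq_bigr => j _.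
by rewrite /= evalFZ !rmorphXn /= -hC evalFX exprMn !rmorphM /= !rmorphXn /= mulrA.
Qed.

Lemma algebraic_dfinite F : (exists A, alg_rel F A) ->
  exists d (c : 'I_d -> {poly K}), (exists i, c i != 0) /\
    \sum_i (c i)%:fps * iter i theta F = 0.
Proof.
move=> hF; have [A hA] := hF; have [W [B [W0 hW]]] := theta_in_span hF.
have [C hC] := choice (iter_theta_in_span hW).
have [|c [[j0 cj0] hc]] := @evalF_dependent F A 'I_(size A) (fun j => C j) hA.
  by rewrite card_ord prednK // size_poly_gt0; case: hA.
exists (size A), (fun j => c j * W ^+ j); split.
  by exists j0; rewrite mulf_neq0 // expf_neq0.
by rewrite -[RHS]hc; apply: eq_bigr => j _; rewrite rmorphM /= -hC mulrA.
Qed.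

Lemma dfinite_recurrence F d (c : 'I_d -> {poly K}) : (exists i, c i != 0) ->
  \sum_i (c i)%:fps * iter i theta F = 0 ->
  exists r (a : nat -> {poly K}) n1, [/\ a 0 != 0, a r != 0 & forall n, (n1 <= n)%N ->
    \sum_(i < r.+1) (a i).[n%:R] * F (n + i)%N = 0].
Proof.
(* [P l] gathers the coefficients of [z ^ l]: the coefficient of [z ^ n] in the equation is the sum
   of the [P l] at [n - l] times [F (n - l)]. *)
move=> [i0 ci0] hc; pose P l := \sum_(i < d) (c i)`_l *: 'X^i : {poly K}.
pose w := (\max_(i < d) size (c i))%N.
have Pw l : (w <= l)%N -> P l = 0.
  move=> wl; rewrite /P big1 // => i _; rewrite nth_default ?scale0r //.
  by apply: leq_trans wl; apply: (@leq_bigmax _ (fun i : 'I_d => size (c i))).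
have Pn0 : exists l, P l != 0.
  apply: contrapT => /forallNP P0; case/eqP: ci0; apply/polyP => l; rewrite coef0; have /negP := P0 l; rewrite negbK => /eqP Pl.
  have := congr1 (fun p : {poly K} => p`_i0) Pl; rewrite coef0 => e.
  rewrite -[RHS]e coef_sum (bigD1 i0) //= coefZ coefXn eqxx mulr1 big1 ?addr0 // => k ki.
  by rewrite coefZ coefXn eq_sym val_eqE (negPf ki) mulr0.
have rec n : \sum_(l < n.+1) (P l).[(n - l)%:R] * F (n - l)%N = 0.
  have := congr1 (fun G : fps K => G n) hc.
  have sumE (I : finType) (G : I -> fps K) : (\sum_i G i) n = \sum_i G i n.
    by apply: (big_morph (fun G : fps K => G n)).
  rewrite sumE => e; rewrite -[RHS]e; under [RHS]eq_bigr do rewrite fpsM.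
  rewrite [RHS]exchange_big /=; apply: eq_bigr => l _.
  rewrite /P horner_sum mulr_suml; apply: eq_bigr => i _.
  by rewrite hornerZ hornerXn iter_thetaE mulrA.
pose b i := if (i <= w)%N then shiftp i (P (w - i)%N) else 0.
have recb m : \sum_(i < w.+1) (b i).[m%:R] * F (m + i)%N = 0.
  rewrite (reindex_inj rev_ord_inj) /= -[RHS](rec (m + w)%N).
  have le : (w.+1 <= (m + w).+1)%N by rewrite ltnS leq_addl.
  rewrite (big_ord_widen_cond _ predT (fun i => (b (w.+1 - i.+1)%N).[m%:R]
    * F (m + (w.+1 - i.+1))%N) le) big_mkcond /=.
  apply: eq_bigr => l _; rewrite subSS /b leq_subr; case: ltnP => lw.
    rewrite horner_shiftp subKn; last by rewrite -ltnS.
    by rewrite addnBA // -ltnS.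
  by rewrite Pw ?hornerE ?mul0r // ltnW.
have exb : exists i, b i != 0.
  have [l Pl] := Pn0; have lw : (l < w)%N.
    by rewrite ltnNge; apply: contra Pl => /Pw ->.
  by exists (w - l)%N; rewrite /b leq_subr subKn ?shiftp_eq0 // ltnW.
have bw i : b i != 0 -> (i <= w)%N by rewrite /b; case: leqP; rewrite ?eqxx.
case: (ex_minnP exb) => lo blo minlo; case: (ex_maxnP exb bw) => hi bhi maxhi.
have lohi : (lo <= hi)%N by apply: minlo.
(* Trimming to the lowest and highest nonzero [b i] makes both end coefficients nonzero; the
   substitution compensates the shift by [lo]. *)
pose a i := b (lo + i)%N \Po ('X - lo%:R%:P).
have a0E i : (a i == 0) = (b (lo + i)%N == 0).
  by rewrite -!size_poly_eq0 size_comp_poly2 // size_XsubC.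
exists (hi - lo)%N, a, lo; split; rewrite ?a0E ?addn0 ?subnKC // => n lon.
rewrite -[RHS](recb (n - lo)%N) -(big_mkord predT (fun i => (b i).[(n - lo)%:R] * F (n - lo + i)%N)).
rewrite (big_cat_nat (n := lo)) //=; last by apply: leq_trans (bw _ blo) _.
rewrite [X in _ = X + _]big_nat [X in _ = X + _]big1 ?add0r; last first.
  move=> i /andP[_ ilo]; have [->|/minlo] := eqVneq (b i) 0; first by rewrite hornerE mul0r.
  by rewrite leqNgt ilo.
rewrite (big_cat_nat (n := hi.+1)) //=; [|by rewrite leqW|by rewrite ltnS bw].
rewrite [X in _ = _ + X]big_nat [X in _ = _ + X]big1 ?addr0; last first.
  move=> i /andP[hii _]; have [->|/maxhi] := eqVneq (b i) 0; first by rewrite hornerE mul0r.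
  by rewrite leqNgt hii.
rewrite -[X in \sum_(X <= _ < _) _]add0n big_addn subSn // big_mkord; apply: eq_bigr => i _.
rewrite /a horner_comp !hornerE -natrB // (addnC i lo); congr (_ * F _).
by rewrite /= addnAC subnK.
Qed.

(** * Rationality from a rational derivative *)

Lemma fpsM_coef_min F G m n : (forall i, (i < m)%N -> F i = 0) ->
  (forall i, (i < n)%N -> G i = 0) -> (F * G) (m + n)%N = F m * G n.
Proof.
move=> Fm Gn; rewrite fpsM; have lt : (m < (m + n).+1)%N by rewrite ltnS leq_addr.
rewrite (bigD1 (Ordinal lt)) //= addKn big1 ?addr0 // => i im.
have [lim|] := ltnP i m; first by rewrite Fm ?mul0r.
rewrite leq_eqVlt => /orP[/eqP e|mi]; first by case/eqP: im; apply: val_inj.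
by rewrite Gn ?mulr0 // ltn_subLR ?ltn_add2r // -ltnS ltn_ord.
Qed.

(** [G / F] has zero derivative. Subtract the multiple of [F] that kills the coefficient at the
    order [m] of [F]: a nonzero remainder of order [n] would satisfy [n = m] by comparing lowest
    coefficients. *)
Lemma wronskian_eq0 F G : F != 0 -> F * theta G = theta F * G ->
  exists c : K, G = (c%:P)%:fps * F.
Proof.
move=> /fps_neq0P[m Fm ltm] e; exists (G m / F m); apply/eqP; rewrite -subr_eq0.
set c := G m / F m; set H := G - _.
have cF n : ((c%:P)%:fps * F) n = c * F n.
  rewrite fpsM big_ord_recl /= coefC subn0 big1 ?addr0 // => i _.
  by rewrite coefC mul0r.
have Hm : H m = 0.
  have -> : H m = G m - ((c%:P)%:fps * F) m by [].
  by rewrite cF /c divfK // subrr.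
apply: contraT => /fps_neq0P[n Hn ltn].
have eH : F * theta H = theta F * H.
  rewrite /H raddfB /= thetaM theta_fps_of_poly /thetap derivC mulr0 raddf0 mul0r add0r.
  by rewrite !mulrBr e; ring.
have tF i : (i < m)%N -> theta F i = 0 by move=> /ltm Fi; rewrite /= Fi mulr0.
have tH i : (i < n)%N -> theta H i = 0 by move=> /ltn Hi; rewrite (_ : theta H i = i%:R * H i) // Hi mulr0.
have : (F * theta H) (m + n)%N = (theta F * H) (m + n)%N by rewrite eH.
rewrite (fpsM_coef_min ltm tH) (fpsM_coef_min tF ltn) => /eqP.
have -> : theta F m = m%:R * F m by [].
have -> : theta H n = n%:R * H n by [].
rewrite mulrCA -[X in _ == X]mulrA -subr_eq0 -mulrBl mulf_eq0 mulf_eq0.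
rewrite (negPf Fm) (negPf Hn) !orbF subr_eq0 => /eqP/(natr_inj_char0 charK0) nm.
by rewrite nm Hm eqxx in Hn.
Qed.

Definition fps_rational F := exists C B : {poly K}, C != 0 /\ C%:fps * F = B%:fps.

(** Differentiating the minimal relation and removing its leading term gives a smaller one, hence 0.
    Its coefficient of index [d.-1] says that [d * F + b / l] has zero derivative. *)
Lemma rational_of_theta F : (exists A, alg_rel F A) -> fps_rational (theta F) ->
  fps_rational F.
Proof.
move=> /min_rel_exists[A hA] [C [B [C0 hC]]]; have sA := min_rel_size hA.
have [[A0 evA] minA] := hA; pose d := (size A).-1.
have dA : d.+1 = size A by rewrite /d prednK // ltnW.
have d0 : (0 < d)%N by rewrite -ltnS dA.
set l := lead_coef A; have l0 : l != 0 by rewrite lead_coef_eq0.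
have lE : A`_d = l by [].
pose E := l *: (C *: map_poly thetap A + B *: A^`()) - (C * thetap l) *: A.
have E0 : E = 0.
  apply: minA.
    rewrite rmorphB /= !evalFZ rmorphD /= !evalFZ evA mulr0 subr0 -hC.
    have := theta_evalF F A; rewrite evA raddf0 => e.
    transitivity (l%:fps * C%:fps * (evalF F (map_poly thetap A) + evalF F A^`() * theta F)).
      by ring.
    by rewrite -e mulr0.
  rewrite -dA ltnS; apply/leq_sizeP => i; rewrite leq_eqVlt => /orP[/eqP<-|di].
    rewrite !(coefB, coefD, coefZ) coef_map coef_deriv /= lE.
    by rewrite (@nth_default _ _ _ d.+1) ?dA // mul0rn; ring.
  rewrite !(coefB, coefD, coefZ) coef_map coef_deriv /=.
  have Ai : A`_i = 0 by rewrite nth_default // -dA.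
  have Ai1 : A`_i.+1 = 0 by rewrite nth_default // -dA ltnW.
  by rewrite Ai Ai1 raddf0 mul0rn; ring.
have := congr1 (fun p : {poly {poly K}} => p`_d.-1) E0.
rewrite !(coefB, coefD, coefZ) coef_map coef_deriv /= coef0 prednK // lE.
set b := A`_d.-1 => Ec.
pose H := (d%:R * l)%:fps * F + b%:fps.
have [||c hc] := @wronskian_eq0 l%:fps H.
- by rewrite -(inj_eq (@fps_of_poly_inj K)) rmorph0 in l0.
- have C0' : C%:fps != 0 :> fps K.
    by rewrite -(inj_eq (@fps_of_poly_inj K)) rmorph0 in C0.
  apply: (mulfI C0'); apply/eqP; rewrite -subr_eq0; apply/eqP.
  rewrite /H raddfD /= thetaM !theta_fps_of_poly.
  have -> : thetap (d%:R * l) = d%:R * thetap l.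
    by rewrite /thetap derivM -polyC_natr derivC mul0r add0r; ring.
  transitivity ((l * (C * thetap b + B * (l *+ d)) - C * thetap l * b)%:fps : fps K).
    rewrite -[l *+ d]mulr_natl !(rmorphB, rmorphD, rmorphM) /= -hC.
    move: l%:fps C%:fps (theta F) (thetap l)%:fps (thetap b)%:fps b%:fps (d%:R)%:fps.
    by move=> ? ? ? ? ? ? ?; ring.
  by rewrite Ec rmorph0.
exists (d%:R * l), (c%:P * l - b); split.
  by rewrite mulf_neq0 // -polyC_natr polyC_eq0 natr_eq0_char0 // -lt0n.
by rewrite rmorphB /= [(c%:P * l)%:fps]rmorphM /= -hc /H addrK.
Qed.

Lemma rational_of_iter_theta F k : (exists A, alg_rel F A) ->
  fps_rational (iter k theta F) -> fps_rational F.
Proof.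
move=> hF; elim: k => // k IHk /= h; apply/IHk/rational_of_theta => //.
exact: algebraic_iter_theta.
Qed.

Lemma periodic_rational (chi : nat -> K) d F : (0 < d)%N ->
  (forall n, (0 < n)%N -> chi (n + d)%N = chi n) ->
  (forall n, (0 < n)%N -> F n = chi n) -> fps_rational F.
Proof.
move=> d0 per FE; pose C : {poly K} := 1 - 'X^d.
(* The coefficient of index [d] is kept because [F 0] need not continue the period. *)
exists C, (\poly_(i < d.+1) ((C%:fps * F) i)); split.
  apply/eqP => /(congr1 (fun p : {poly K} => p`_0)) /eqP.
  by rewrite coef0 coefB coef1 coefXn (ltn_eqF d0) /= subr0 oner_eq0.
apply: fpsP => n /=; rewrite coef_poly; case: ltnP => // dn.
have Xd : (('X^d)%:fps * F) n = F (n - d)%N.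
  rewrite fpsM; have lt : (d < n.+1)%N by rewrite ltnS ltnW.
  rewrite (bigD1 (Ordinal lt)) //= coefXn eqxx mul1r big1 ?addr0 // => i id.
  rewrite coefXn; case: eqP => [e|]; last by rewrite mul0r.
  by case/eqP: id; apply: val_inj.
have -> : \sum_(i < n.+1) C`_i * F (n - i)%N = (F - ('X^d)%:fps * F) n.
  transitivity ((C%:fps * F) n) => //.
  by rewrite /C rmorphB rmorph1 mulrBl mul1r.
have -> : (F - ('X^d)%:fps * F) n = F n - (('X^d)%:fps * F) n by [].
have nd0 : (0 < n - d)%N by rewrite subn_gt0.
rewrite Xd !FE ?(leq_trans _ dn) // -{1}(subnK (ltnW dn)) per // subrr //.
Qed.

(** [F] is rational because an iterate of [theta] makes it periodic. Rationality gives a linear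
    relation between the [chi (n - l) / (n - l) ^ k.+1], whose poles are distinct. *)
Lemma inverse_power_not_algebraic (f chi : nat -> K) k d F : (0 < d)%N ->
  (forall n, (0 < n)%N -> chi (n + d)%N = chi n) ->
  (forall n, (0 < n)%N -> F n = f n) ->
  (forall n, (0 < n)%N -> n%:R ^+ k.+1 * f n = chi n) ->
  (exists A, alg_rel F A) -> forall n, (0 < n)%N -> f n = 0.
Proof.
move=> d0 per FE fE hF.
have [C [B [C0 hC]]] : fps_rational F.
  apply: (rational_of_iter_theta (k := k.+1) hF).
  by apply: (periodic_rational d0 per) => n n0; rewrite iter_thetaE FE // fE.
have perD t n : (0 < n)%N -> chi (n + d * t)%N = chi n.
  move=> n0; elim: t => [|t IHt]; first by rewrite muln0 addn0.
  by rewrite mulnSr addnA per // addn_gt0 n0.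
have [l0 Cl0] : exists l, C`_l != 0.
  by exists (size C).-1; rewrite -lead_coefE lead_coef_eq0.
pose s := size C; have l0s : (l0 < s)%N.
  by rewrite ltnNge; apply: contra Cl0 => /(nth_default _) ->.
(* The value of [chi (n - l)] for [n] in the class of [b + l0] modulo [d]; the term [d * s] keeps
   the subtraction positive. *)
move=> b b0; pose x l := chi (b + l0 + d * s - l)%N.
have pos (l : 'I_s) : (0 < b + l0 + d * s - l)%N.
  rewrite subn_gt0; apply: leq_trans (ltn_ord l) _.
  by apply: leq_trans (leq_pmull _ d0) (leq_addl _ _).
pose p := \sum_(l < s) (C`_l * x l) *: \prod_(j < s | j != l) ('X - j%:R%:P) ^+ k.+1 : {poly K}.
have p0 : p = 0.
  apply/eqP; rewrite -(affp_eq0 charK0 (b + l0) _ d0); apply/eqP.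
  apply: (poly_near_zero_eq0 charK0); exists 1%N, (s + size B)%N; split=> // t le _.
  rewrite horner_affp; set n := (b + l0 + d * t)%N.
  have tn : (t <= n)%N by apply: leq_trans (leq_pmull _ d0) (leq_addl _ _).
  have sn : (s <= n)%N by apply: leq_trans (leq_trans (leq_addr _ _) le) tn.
  have Bn : (size B <= n)%N by apply: leq_trans (leq_trans (leq_addl _ _) le) tn.
  have nl (l : 'I_s) : (0 < n - l)%N by rewrite subn_gt0; apply: leq_trans sn.
  have := congr1 (fun G : fps K => G n) hC; rewrite /= (nth_default _ Bn) => e.
  have {}e : \sum_(l < s) C`_l * f (n - l)%N = 0.
    rewrite -[RHS]e (big_ord_widen_cond n.+1 predT (fun l => C`_l * f (n - l)%N)) ?leqW //.
    rewrite big_mkcond; apply: eq_bigr => l _; rewrite /= -/s; case: ltnP => ls.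
      by rewrite FE // (nl (Ordinal ls)).
    by rewrite nth_default // mul0r.
  have xE (l : 'I_s) : x l = (n%:R - l%:R) ^+ k.+1 * f (n - l)%N.
    rewrite -natrB; last by apply: ltnW; apply: leq_trans (ltn_ord l) sn.
    rewrite fE // /x -(perD (t - s)%N _ (pos l)); congr chi; rewrite /n.
    have st : (s <= t)%N by apply: leq_trans (leq_addr _ _) le.
    have -> : (d * t = d * s + d * (t - s))%N by rewrite -mulnDr subnKC.
    by have := pos l; move: (d * s)%N (d * (t - s))%N => u v; lia.
  rewrite /p horner_sum.
  transitivity (\prod_(j < s) (n%:R - j%:R : K) ^+ k.+1 * \sum_(l < s) C`_l * f (n - l)%N).
    rewrite mulr_sumr; apply: eq_bigr => l _; rewrite hornerZ horner_prod xE.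
    have -> : \prod_(j < s | j != l) (('X - j%:R%:P) ^+ k.+1).[n%:R]
        = \prod_(j < s | j != l) (n%:R - j%:R : K) ^+ k.+1.
      by apply: eq_bigr => j _; rewrite horner_exp hornerXsubC.
    by rewrite [in RHS](bigD1 l) //=; ring.
  by rewrite e mulr0.
(* At the pole [l0] all other terms vanish, and [x l0] is [chi b]. *)
have := congr1 (fun q : {poly K} => q.[l0%:R]) p0; rewrite /= hornerC /p horner_sum.
rewrite (bigD1 (Ordinal l0s)) //= [X in _ + X]big1 ?addr0; last first.
  move=> l ll; rewrite hornerZ horner_prod (bigD1 (Ordinal l0s)) 1?eq_sym //=.
  by rewrite horner_exp hornerXsubC subrr exprS !mul0r mulr0.
rewrite hornerZ horner_prod => /eqP; rewrite mulf_eq0 mulf_eq0 (negPf Cl0) /=.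
rewrite orbC => /orP[/prodf_eq0[j jl]|].
  rewrite horner_exp hornerXsubC expf_eq0 /= subr_eq0 => /eqP/(natr_inj_char0 charK0) e.
  by case/eqP: jl; apply: val_inj.
rewrite /x addnAC addnK perD // -fE // mulf_eq0 expf_eq0 /= natr_eq0_char0 //.
by rewrite gtn_eqF //= => /eqP.
Qed.

End Theta.

(** * Conclusion: from the germ at 1 to all integers *)

Lemma multiplicative_near_zero (K : fieldType) (f : nat -> K) b :
  multiplicative_fun f -> (0 < b)%N ->
  near_zero (fun n => (b %| n)%N /\ f (n + b)%N = f b * f (n %/ b + 1)%N).
Proof.
move=> f_mult b0; have bb0 : (0 < b * b)%N by rewrite muln_gt0 b0.
apply: near_zero_mono (near_zero_dvd bb0) => n bbn.
have bn : (b %| n)%N by apply: dvdn_trans bbn; apply: dvdn_mulr.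
split=> //; rewrite -f_mult ?addn1 //; first by rewrite mulnSr (mulnC b) divnK.
case/dvdnP: bbn => k ->; rewrite mulnA mulnK // -addn1 -coprime_modr modnMDl.
by rewrite coprime_modr coprimen1.
Qed.

Theorem theorem1p5 (K : fieldType) (charK0 : [pchar K] =i pred0)
    (f : nat -> K) (f_mult : multiplicative_fun f)
    (F_alg : fps_algebraic (generating_series f)) :
  (exists (k : nat) (chi : nat -> K),
     [/\ periodic_fun chi, multiplicative_fun chi
       & forall n : nat, (0 < n)%N -> f n = n%:R ^+ k * chi n])
  \/ eventually_zero f.
Proof.
have hF := fps_algebraic_rel F_alg.
have FE n : (0 < n)%N -> generating_series f n = f n by case: n.
have [d0 [c [c0 hc]]] := algebraic_dfinite charK0 hF.
have [r [a [n1 [a_lo a_hi F_rec]]]] := dfinite_recurrence c0 hc.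
have f_rec n : (n1.+1 <= n)%N -> \sum_(i < r.+1) (a i).[n%:R] * f (n + i)%N = 0.
  move=> n1n; rewrite -[RHS](F_rec n (ltnW n1n)); apply: eq_bigr => i _.
  by rewrite FE // addn_gt0 (leq_trans _ n1n).
have [L0 [n0 [L00 unif [Z [tau [g [m0 [Z0 g0 hg]]]]]]]] :=
  germ_structure charK0 f_rec a_lo a_hi f_mult.
have natK n : (0 < n)%N -> n%:R != 0 :> K by rewrite natr_eq0_char0 // -lt0n.
have [hz|[j [k hjk]]] := germ_dichotomy charK0 f_mult Z0 L00 g0 hg.
  (* The germ at [b] is [f b] times the dilated germ at 1, hence zero; [unif] makes it vanish at the
     actual point [L0 * n0]. *)
  right; exists (L0 * n0)%N => n nN; pose b := (n - L0 * n0)%N.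
  have b0 : (0 < b)%N by rewrite subn_gt0.
  have := unif _ (fun _ : 'I_1 => b) (fun=> 1) (fun=> b0) _ (L0 * n0)%N
    (leq_pmull _ L00) (dvdn_mulr _ (dvdnn _)).
  rewrite big_ord1 hornerC mul1r subnKC; last exact: ltnW.
  apply; apply: near_zero_mono (near_zeroI (near_zero_div b0 hz)
    (multiplicative_near_zero f_mult b0)) => m [e [_ e']].
  by rewrite big_ord1 e' e !mulr0.
(* A single point [d] where both [unif] and the monomial formula for [f (d + 1)] apply; it becomes
   the period of [chi]. *)
have [d [dn0 L0d hd]] := near_zero_ex n0.+1 L00 hjk.
have d_gt0 : (0 < d)%N by apply: leq_trans dn0.
have shift b : (0 < b)%N ->
    f (d + b)%N * (d + b)%:R ^+ j * b%:R ^+ k = f b * b%:R ^+ j * (d + b)%:R ^+ k.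
  (* [lb] and [l1] encode, without denominators, the proportionality of the germs at [b] and at 1;
     [unif] transports it to [n = d]. *)
  move=> b0; pose lb := b%:R ^+ k *: (shiftp b 'X ^+ j * shiftp 1 'X ^+ k) : {poly K}.
  pose l1 := - (f b * b%:R ^+ j) *: (shiftp b 'X ^+ k * shiftp 1 'X ^+ j) : {poly K}.
  have hl n : lb.[n%:R] * f (n + b)%N + l1.[n%:R] * f (n + 1)%N =
    f (n + b)%N * (n + b)%:R ^+ j * b%:R ^+ k * (n + 1)%:R ^+ k
    - f b * b%:R ^+ j * (n + b)%:R ^+ k * (f (n + 1)%N * (n + 1)%:R ^+ j).
    by rewrite !hornerZ !hornerM !horner_exp !horner_shiftp !hornerX; ring.
  have := unif _ (fun t : bool => if t then b else 1%N) (fun t => if t then lb else l1) _ _ d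
    (ltnW dn0) L0d.
  rewrite big_bool /= hl hd => /(_ _ _)/eqP; rewrite subr_eq0 => e.
  apply: (mulIf (expf_neq0 k (natK (d + 1)%N _))); first by rewrite addn1.
  apply/eqP; apply: e; first by case.
  apply: near_zero_mono (near_zeroI (near_zeroI (near_zero_div b0 hjk) hjk)
    (multiplicative_near_zero f_mult b0)) => n [[e1 e2] [bn e3]].
  rewrite big_bool /= hl e2 e3.
  have -> : (n + b = b * (n %/ b + 1))%N by rewrite mulnDr muln1 mulnC divnK.
  move: e1; set w := (n %/ b + 1)%N => e1; rewrite natrM !exprMn.
  transitivity (f b * b%:R ^+ j * b%:R ^+ k * (n + 1)%:R ^+ k *
    (f w * w%:R ^+ j - w%:R ^+ k)); first by ring.
  by rewrite e1 subrr mulr0.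
pose chi n := f n * n%:R ^+ j / n%:R ^+ k.
have chi_per n : (0 < n)%N -> chi (n + d)%N = chi n.
  move=> n_gt0; have [e1 e2] : (n%:R ^+ k != 0 :> K) /\ ((d + n)%:R ^+ k != 0 :> K).
    by split; apply/expf_neq0/natK; rewrite // addn_gt0 n_gt0 orbT.
  rewrite /chi addnC; apply/eqP; rewrite eqr_div //; apply/eqP; rewrite shift //; ring.
have chi_mult : multiplicative_fun chi.
  move=> m n m_gt0 n_gt0 cop; rewrite /chi f_mult // natrM !exprMn invfM; ring.
have [jk|kj] := leqP j k.
  left; exists (k - j)%N, chi; split=> //; first by exists d.
  move=> n n_gt0; apply: (mulIf (expf_neq0 j (natK _ n_gt0))).
  by rewrite mulrAC -exprD subnK // /chi [RHS]mulrC divfK // expf_neq0 // natK.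
right; exists 0%N => n n_gt0.
apply: (@inverse_power_not_algebraic _ charK0 f chi (j - k).-1 d _ d_gt0 chi_per FE) => //.
move=> m m_gt0; rewrite prednK ?subn_gt0 // /chi -{2}(subnK (ltnW kj)) exprD.
by rewrite mulrA mulfK ?expf_neq0 ?natK // mulrC.
Qed.
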